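(* Let $n_x,n_y$ be relatively prime positive integers and let $\mathcal{L}(n_x,n_y)=\bigcup_{n_z\in\mathbb{N}}\mathcal{L}(n_x,n_y,n_z)$. Then $$|\mathcal{L}(n_x,n_y)|\le 4n_xn_y(n_x-1)(n_y-1).$$ If furthermore $n_x=2$, then $$|\mathcal{L}(2,n_y)|\le 2(n_y-1)(2n_y+1).$$
   Context: A Lissajous knot is a knot in $\mathbb{R}^3$ admitting a parameterization $K(t)=(\cos(n_xt+\phi_x),\cos(n_yt+\phi_y),\cos(n_zt+\phi_z))$, $0\le t\le 2\pi$, where the frequencies are integers and the phase shifts real numbers (chosen so that the curve is embedded; this forces $n_x,n_y,n_z$ to be pairwise relatively prime). $\mathcal{L}(n_x,n_y,n_z)$ denotes the set of knot types of all Lissajous knots with frequencies $n_x,n_y,n_z$ (empty if no such knot exists), a knot and its mirror image being considered equivalent.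
   Formalization: The formal theorem requires n_x, n_y ≥ 2 instead of merely positive: if n_x = 1 or n_y = 1 the bounds equal 0, although unknotted Lissajous curves such as (cos t, cos(n_y t), sin t) exist, so the statement fails in every excluded case. *)

(* Defs.v *)
From Stdlib Require Import Reals Lra List.
Import ListNotations.
Open Scope R_scope.

Definition pt3 := (R * R * R)%type.
Definition curve := R -> pt3.

Definition dist3 (p q : pt3) : R :=
  let '(x1, y1, z1) := p in let '(x2, y2, z2) := q in
  sqrt ((x1 - x2)^2 + (y1 - y2)^2 + (z1 - z2)^2).

Definition continuous3 (f : pt3 -> pt3) : Prop :=
  forall p eps, 0 < eps -> exists delta, 0 < delta /\
    forall q, dist3 p q < delta -> dist3 (f p) (f q) < eps.

Definition homeo3 (h : pt3 -> pt3) : Prop :=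
  exists g : pt3 -> pt3, continuous3 h /\ continuous3 g /\
    (forall p, g (h p) = p) /\ (forall p, h (g p) = p).

(* Same knot type, a knot and its mirror image being identified:
   some homeomorphism of R^3 (orientation preserving or reversing)
   maps the image of K1 onto the image of K2. *)
Definition knot_equiv (K1 K2 : curve) : Prop :=
  exists h, homeo3 h /\
    (forall t, exists s, h (K1 t) = K2 s) /\
    (forall s, exists t, h (K1 t) = K2 s).

Definition liss (nx ny nz : nat) (px py pz : R) : curve :=
  fun t => (cos (INR nx * t + px), cos (INR ny * t + py), cos (INR nz * t + pz)).

Definition embedded (K : curve) : Prop :=
  forall t s, 0 <= t < 2 * PI -> 0 <= s < 2 * PI -> K t = K s -> t = s.

Definition lissajous_knot (nx ny nz : nat) (K : curve) : Prop :=
  exists px py pz, K = liss nx ny nz px py pz /\ embedded K.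

Definition lissajous_knot2 (nx ny : nat) (K : curve) : Prop :=
  exists nz : nat, lissajous_knot nx ny nz K.

(* The set of knot types of curves satisfying P has at most N elements:
   every list of pairwise inequivalent such curves has length <= N. *)
Definition at_most_types (P : curve -> Prop) (N : nat) : Prop :=
  forall l : list curve, Forall P l ->
    ForallOrdPairs (fun K1 K2 => ~ knot_equiv K1 K2) l ->
    (length l <= N)%nat.

(* Main.v *)
Require Import Defs.
From Stdlib Require Import Reals List Arith.
From Stdlib Require Import ZArith Znumtheory Lra Lia Classical.
From Coquelicot Require Import Coquelicot.
Open Scope R_scope.

(** A vertical homeomorphism (x, y, z) -> (x, y, f (x, y, z)) carries one curve onto another with the
    same regular planar projection as soon as both have the same order at every double point: a
    McShane-type infimum formula gives such an f, bi-Lipschitz in z. Hence only crossing signs matter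
    while the projection (cos (p t), cos (q t + phi)) is fixed, and phi itself can be moved slightly by
    the same device applied in the y direction.

    At the double points the sign of z(s) - z(t), z = cos (n t + psi), depends on n mod 2pq and on the
    integer parts of two "levels" a (from psi) and b (from psi and phi), modulo 2p and 2q. Replacing z by
    cos (n t + psi + c sin^2 (p q t)) makes a and b independent of phi, so phi can be deformed to
    pi / (2 p) with a and b held fixed. Modulo (n, a, b) ~ (-n, -a, -b) and (a, b) ~ (a + p, b + q) (a
    reflection in z) one finds 0 < n < pq coprime to p and q, at most (p-1)(q-1) choices, with p choices
    for the integer part of a and 2q for that of b: at most 2pq(p-1)(q-1) knot types, which is below both
    bounds. *)

(** * Homeomorphisms of space and curves *)

Definition dist1 (p q : pt3) : R :=
  let '(x1, y1, z1) := p in let '(x2, y2, z2) := q in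
  Rabs (x1 - x2) + Rabs (y1 - y2) + Rabs (z1 - z2).

Lemma dist3_le_dist1 (p q : pt3) : dist3 p q <= dist1 p q.
Proof.
  destruct p as [[x1 y1] z1], q as [[x2 y2] z2]; simpl.
  pose proof (Rabs_pos (x1 - x2)); pose proof (Rabs_pos (y1 - y2)); pose proof (Rabs_pos (z1 - z2)).
  rewrite <- (sqrt_pow2 (Rabs (x1 - x2) + _ + _)) by lra.
  apply sqrt_le_1_alt.
  pose proof (pow2_abs (x1 - x2)); pose proof (pow2_abs (y1 - y2)); pose proof (pow2_abs (z1 - z2)).
  simpl in *. nra.
Qed.

Lemma dist1_le_dist3 (p q : pt3) : dist1 p q <= 3 * dist3 p q.
Proof.
  destruct p as [[x1 y1] z1], q as [[x2 y2] z2]; unfold dist1, dist3.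
  assert (H : forall u v, 0 <= v -> Rabs u <= sqrt (u ^ 2 + v)).
  { intros u v Hv. rewrite <- (sqrt_pow2 (Rabs u)) by apply Rabs_pos.
    apply sqrt_le_1_alt. rewrite pow2_abs. lra. }
  pose proof (pow2_ge_0 (x1 - x2)); pose proof (pow2_ge_0 (y1 - y2)); pose proof (pow2_ge_0 (z1 - z2)).
  pose proof (H (x1 - x2) ((y1 - y2) ^ 2 + (z1 - z2) ^ 2) ltac:(lra)).
  pose proof (H (y1 - y2) ((x1 - x2) ^ 2 + (z1 - z2) ^ 2) ltac:(lra)).
  pose proof (H (z1 - z2) ((x1 - x2) ^ 2 + (y1 - y2) ^ 2) ltac:(lra)).
  replace ((y1 - y2) ^ 2 + ((x1 - x2) ^ 2 + (z1 - z2) ^ 2))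
    with ((x1 - x2) ^ 2 + ((y1 - y2) ^ 2 + (z1 - z2) ^ 2)) in * by ring.
  replace ((z1 - z2) ^ 2 + ((x1 - x2) ^ 2 + (y1 - y2) ^ 2))
    with ((x1 - x2) ^ 2 + ((y1 - y2) ^ 2 + (z1 - z2) ^ 2)) in * by ring.
  rewrite <- Rplus_assoc in *. lra.
Qed.

Lemma lipschitz_continuous3 (f : pt3 -> pt3) (C : R) :
  0 < C -> (forall p q, dist1 (f p) (f q) <= C * dist1 p q) -> continuous3 f.
Proof.
  intros HC Hf p eps Heps. exists (eps / (3 * C)). split.
  { apply Rdiv_lt_0_compat; lra. }
  intros q Hq.
  pose proof (dist3_le_dist1 (f p) (f q)); pose proof (Hf p q); pose proof (dist1_le_dist3 p q).
  assert (dist3 p q * (3 * C) < eps).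
  { apply (Rmult_lt_compat_r (3 * C)) in Hq; [|lra].
    unfold Rdiv in Hq. rewrite Rmult_assoc, Rinv_l, Rmult_1_r in Hq; lra. }
  nra.
Qed.

Lemma homeo3_comp (h k : pt3 -> pt3) : homeo3 h -> homeo3 k -> homeo3 (fun p => k (h p)).
Proof.
  intros (g & Hh & Hg & H1 & H2) (l & Hk & Hl & H3 & H4).
  exists (fun p => g (l p)). repeat split.
  - intros p eps He. destruct (Hk (h p) eps He) as (d & Hd & H).
    destruct (Hh p d Hd) as (d' & Hd' & H'). exists d'. auto.
  - intros p eps He. destruct (Hg (l p) eps He) as (d & Hd & H).
    destruct (Hl p d Hd) as (d' & Hd' & H'). exists d'. auto.
  - intros p. now rewrite H3.
  - intros p. now rewrite H2.
Qed.

Lemma homeo3_lipschitz_involution (h : pt3 -> pt3) :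
  (forall p q, dist1 (h p) (h q) <= 1 * dist1 p q) -> (forall p, h (h p) = p) -> homeo3 h.
Proof.
  intros H1 H2. exists h. repeat split; auto; apply (lipschitz_continuous3 h 1); auto; lra.
Qed.

(* Stronger than [knot_equiv]: the homeomorphism respects the parametrizations,
   so embeddedness is transported along it. *)
Definition carries (K1 K2 : curve) : Prop :=
  exists h, homeo3 h /\ forall t, h (K1 t) = K2 t.

Lemma carries_refl (K : curve) : carries K K.
Proof.
  exists (fun p => p). split; auto.
  apply homeo3_lipschitz_involution; auto. intros; lra.
Qed.

Lemma carries_ext (K1 K2 : curve) : (forall t, K1 t = K2 t) -> carries K1 K2.
Proof.
  intros H. destruct (carries_refl K1) as (h & Hh & E). exists h. split; auto.
  intros t. now rewrite E.
Qed.

Lemma carries_sym (K1 K2 : curve) : carries K1 K2 -> carries K2 K1.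
Proof.
  intros (h & (g & Hh & Hg & H1 & H2) & H). exists g. split.
  - exists h; auto.
  - intros t. now rewrite <- H.
Qed.

Lemma carries_trans (K1 K2 K3 : curve) : carries K1 K2 -> carries K2 K3 -> carries K1 K3.
Proof.
  intros (h & Hh & H) (k & Hk & H'). exists (fun p => k (h p)). split.
  - now apply homeo3_comp.
  - intros t. now rewrite H, H'.
Qed.

Lemma carries_inj (K1 K2 : curve) (s t : R) : carries K1 K2 -> K2 s = K2 t -> K1 s = K1 t.
Proof.
  intros (h & (g & _ & _ & H1 & _) & H) E. rewrite <- (H1 (K1 s)), <- (H1 (K1 t)), !H. congruence.
Qed.

Lemma knot_equiv_carries (K1 K2 : curve) : carries K1 K2 -> knot_equiv K1 K2.
Proof. intros (h & Hh & H). exists h. repeat split; auto; intros t; exists t; auto. Qed.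

Lemma knot_equiv_sym (K1 K2 : curve) : knot_equiv K1 K2 -> knot_equiv K2 K1.
Proof.
  intros (h & (g & Hh & Hg & H1 & H2) & Ha & Hb). exists g. split; [exists h; auto|]. split.
  - intros t. destruct (Hb t) as [s E]. exists s. now rewrite <- E.
  - intros t. destruct (Ha t) as [s E]. exists s. now rewrite <- E.
Qed.

Lemma knot_equiv_trans (K1 K2 K3 : curve) : knot_equiv K1 K2 -> knot_equiv K2 K3 -> knot_equiv K1 K3.
Proof.
  intros (h & Hh & Ha & Hb) (k & Hk & Hc & Hd). exists (fun p => k (h p)).
  split; [now apply homeo3_comp|]. split.
  - intros t. destruct (Ha t) as [s E]. rewrite E. auto.
  - intros t. destruct (Hd t) as [s E]. destruct (Hb s) as [r E']. exists r. now rewrite E'.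
Qed.

Lemma knot_equiv_time_shift (K : curve) (c : R) : knot_equiv K (fun t => K (t + c)).
Proof.
  destruct (carries_refl K) as (h & Hh & E). exists h. split; [exact Hh|]. split.
  - intros t. exists (t - c). rewrite E. f_equal. ring.
  - intros t. exists (t + c). now rewrite E.
Qed.

Definition curve3 (x y z : R -> R) : curve := fun t => (x t, y t, z t).

Lemma carries_swap_yz (x y z : R -> R) : carries (curve3 x y z) (curve3 x z y).
Proof.
  exists (fun p => let '(a, b, c) := p in (a, c, b)). split; [|reflexivity].
  apply homeo3_lipschitz_involution.
  - intros [[a b] c] [[a' b'] c']. simpl. lra.
  - intros [[a b] c]. reflexivity.
Qed.

Lemma sign_abs (e u v : R) : e = 1 \/ e = -1 -> Rabs (e * u - e * v) = Rabs (u - v).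
Proof.
  intros [->| ->]; [f_equal; ring|rewrite <- Rabs_Ropp; f_equal; ring].
Qed.

Lemma carries_reflect (e1 e2 e3 : R) (x y z : R -> R) :
  e1 = 1 \/ e1 = -1 -> e2 = 1 \/ e2 = -1 -> e3 = 1 \/ e3 = -1 ->
  carries (curve3 x y z) (curve3 (fun t => e1 * x t) (fun t => e2 * y t) (fun t => e3 * z t)).
Proof.
  intros H1 H2 H3.
  exists (fun p => let '(a, b, c) := p in (e1 * a, e2 * b, e3 * c)). split; [|reflexivity].
  apply homeo3_lipschitz_involution.
  - intros [[a b] c] [[a' b'] c']. simpl. rewrite !sign_abs by auto. lra.
  - intros [[a b] c].
    assert (E : forall e u, e = 1 \/ e = -1 -> e * (e * u) = u) by (intros e u [->| ->]; ring).
    now rewrite !E.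
Qed.

(** * Vertical homeomorphisms from Lipschitz extensions *)

(** Pointwise infima are obtained as minus the least upper bound of [- F q t] over [t]. Since
    [completeness] returns that bound as data, [f] is a genuine function of [q]. *)
Lemma infimum_family (A : Type) (F : A -> R -> R) :
  (forall q, exists c, forall t, c <= F q t) ->
  exists f : A -> R, (forall q t, f q <= F q t) /\
    (forall q c, (forall t, c <= F q t) -> c <= f q).
Proof.
  intros HF.
  assert (B : forall q, bound (fun v => exists t, v = - F q t)).
  { intros q. destruct (HF q) as [c Hc]. exists (- c). intros v [t ->]. specialize (Hc t). lra. }
  assert (E : forall q, exists v, exists t, v = - F q t) by (intros q; exists (- F q 0), 0; auto).
  exists (fun q => - proj1_sig (completeness _ (B q) (E q))). split.
  - intros q t. destruct (completeness _ (B q) (E q)) as [m [Hm Hm']]; simpl.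
    specialize (Hm (- F q t) (ex_intro _ t eq_refl)). lra.
  - intros q c Hc. destruct (completeness _ (B q) (E q)) as [m [Hm' Hm]]; simpl.
    assert (m <= - c); [|lra]. apply Hm. intros v [t ->]. specialize (Hc t). lra.
Qed.

(** A slope of at least [m > 0] in [z] makes the map bijective on every vertical line, with the
    preimage found by the intermediate value theorem. The same lower slope bound makes the inverse
    Lipschitz, the upper bounds [M] and [L] do so for the map itself. *)
Lemma shear_homeo3 (f : R * R * R -> R) (m M L : R) :
  0 < m -> 0 <= L ->
  (forall x y z z', z <= z' -> m * (z' - z) <= f (x, y, z') - f (x, y, z) <= M * (z' - z)) ->
  (forall x y x' y' z, f (x, y, z) - f (x', y', z) <= L * (Rabs (x - x') + Rabs (y - y'))) ->
  homeo3 (fun p => let '(x, y, z) := p in (x, y, f (x, y, z))).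
Proof.
  intros Hm HL Hz Hp.
  assert (HM : 0 < M). { specialize (Hz 0 0 0 1 ltac:(lra)). lra. }
  assert (Hza : forall x y z z', m * Rabs (z - z') <= Rabs (f (x, y, z) - f (x, y, z')) <= M * Rabs (z - z')).
  { intros x y z z'. destruct (Rle_dec z z') as [H|H].
    - specialize (Hz x y z z' H). rewrite (Rabs_minus_sym z), (Rabs_minus_sym (f _)).
      rewrite !Rabs_pos_eq; nra.
    - specialize (Hz x y z' z ltac:(lra)). rewrite !Rabs_pos_eq; nra. }
  assert (Hpa : forall x y x' y' z, Rabs (f (x, y, z) - f (x', y', z)) <= L * (Rabs (x - x') + Rabs (y - y'))).
  { intros x y x' y' z. apply Rabs_le. pose proof (Hp x y x' y' z). pose proof (Hp x' y' x y z).
    rewrite (Rabs_minus_sym x' x), (Rabs_minus_sym y' y) in *. lra. }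
  assert (S : forall x y v, {z | f (x, y, z) = v}).
  { intros x y v. set (d := Rabs (v - f (x, y, 0)) / m).
    assert (Hd : 0 <= d) by (apply Rdiv_le_0_compat; [apply Rabs_pos|lra]).
    assert (Ed : m * d = Rabs (v - f (x, y, 0))) by (unfold d; field; lra).
    pose proof (Rle_abs (v - f (x, y, 0))). pose proof (Rle_abs (- (v - f (x, y, 0)))).
    rewrite Rabs_Ropp in *.
    destruct (IVT_cor (fun z => f (x, y, z) - v) (- d) d) as [z [_ E]].
    - intros z eps He. exists (eps / M). split; [apply Rdiv_lt_0_compat; lra|].
      intros z' [_ H']. simpl in *. unfold R_dist in *.
      replace (f (x, y, z') - v - (f (x, y, z) - v)) with (f (x, y, z') - f (x, y, z)) by ring.
      destruct (Hza x y z' z) as [_ H2].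
      apply (Rmult_lt_compat_l M) in H'; [|lra].
      replace (M * (eps / M)) with eps in H' by (field; lra). lra.
    - lra.
    - pose proof (Hz x y 0 d Hd). pose proof (Hz x y (- d) 0 ltac:(lra)).
      assert (f (x, y, - d) - v <= 0) by nra. assert (0 <= f (x, y, d) - v) by nra. nra.
    - exists z. lra. }
  exists (fun p => let '(x, y, v) := p in (x, y, proj1_sig (S x y v))). repeat split.
  - apply (lipschitz_continuous3 _ (1 + L + M)); [lra|].
    intros [[x y] z] [[x' y'] z']. simpl.
    destruct (Hza x y z z') as [_ H1]. pose proof (Hpa x y x' y' z').
    pose proof (Rabs_triang (f (x, y, z) - f (x, y, z')) (f (x, y, z') - f (x', y', z'))).
    replace (f (x, y, z) - f (x, y, z') + (f (x, y, z') - f (x', y', z')))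
      with (f (x, y, z) - f (x', y', z')) in * by ring.
    pose proof (Rabs_pos (x - x')). pose proof (Rabs_pos (y - y')). pose proof (Rabs_pos (z - z')). nra.
  - assert (Hi : 0 < / m) by (now apply Rinv_0_lt_compat).
    apply (lipschitz_continuous3 _ (1 + (1 + L) * / m)).
    { assert (0 < (1 + L) * / m) by (apply Rmult_lt_0_compat; lra). lra. }
    intros [[x y] v] [[x' y'] v']. simpl.
    destruct (S x y v) as [z E], (S x' y' v') as [z' E']; simpl.
    destruct (Hza x y z z') as [H1 _]. pose proof (Hpa x' y' x y z').
    pose proof (Rabs_triang (v - v') (f (x', y', z') - f (x, y, z'))).
    replace (v - v' + (f (x', y', z') - f (x, y, z')))
      with (f (x, y, z) - f (x, y, z')) in * by (rewrite E, E'; ring).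
    rewrite (Rabs_minus_sym x' x), (Rabs_minus_sym y' y) in *.
    pose proof (Rabs_pos (x - x')). pose proof (Rabs_pos (y - y')). pose proof (Rabs_pos (v - v')).
    assert (Rabs (z - z') <= (1 + L) * / m * (Rabs (x - x') + Rabs (y - y') + Rabs (v - v'))).
    { apply (Rmult_le_reg_l m); [lra|].
      replace (m * ((1 + L) * / m * (Rabs (x - x') + Rabs (y - y') + Rabs (v - v'))))
        with ((1 + L) * (Rabs (x - x') + Rabs (y - y') + Rabs (v - v'))) by (field; lra).
      nra. }
    nra.
  - intros [[x y] z]. destruct (S x y (f (x, y, z))) as [z' E]; simpl.
    destruct (Hza x y z' z) as [H1 _]. rewrite E, Rminus_diag, Rabs_R0 in H1.
    assert (Rabs (z' - z) = 0) by (pose proof (Rabs_pos (z' - z)); nra).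
    f_equal. destruct (Req_dec z' z) as [|N]; auto. exfalso. apply (Rabs_no_R0 (z' - z)); lra.
  - intros [[x y] v]. destruct (S x y v) as [z E]; simpl. now rewrite E.
Qed.

(* McShane-type extension for the asymmetric norm L(|x|+|y|) + max(M z, m z): the infimum inherits
   slopes between m and M in z, hence is a homeomorphism on every vertical line. *)
Lemma carries_vertical (x y z1 z2 : R -> R) (m M L B : R) :
  0 < m -> m <= M -> 0 <= L -> (forall t, Rabs (z1 t) <= B) -> (forall t, Rabs (z2 t) <= B) ->
  (forall s t, z2 s - z2 t <= L * (Rabs (x s - x t) + Rabs (y s - y t))
                 + Rmax (M * (z1 s - z1 t)) (m * (z1 s - z1 t))) ->
  carries (curve3 x y z1) (curve3 x y z2).
Proof.
  intros Hm HmM HL B1 B2 H.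
  set (F := fun (q : R * R * R) t => let '(a, b, c) := q in
     z2 t + L * (Rabs (a - x t) + Rabs (b - y t)) + Rmax (M * (c - z1 t)) (m * (c - z1 t))).
  destruct (infimum_family _ F) as (f & Hf1 & Hf2).
  (* Bounding the maximum by its branch [m * (c - z1 t)] and using [|z1|, |z2| <= B] gives a lower
     bound uniform in [t]. *)
  { intros [[a b] c]. exists (- B + m * (c - B)). intros t. simpl.
    pose proof (Rabs_pos (a - x t)). pose proof (Rabs_pos (b - y t)).
    pose proof (Rmax_r (M * (c - z1 t)) (m * (c - z1 t))).
    pose proof (proj1 (Rabs_le_between _ _) (B1 t)).
    pose proof (proj1 (Rabs_le_between _ _) (B2 t)).
    assert (0 <= L * (Rabs (a - x t) + Rabs (b - y t))) by nra. nra. }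
  exists (fun p => let '(a, b, c) := p in (a, b, f (a, b, c))). split.
  - apply (shear_homeo3 f m M L); auto.
    + intros a b c c' Hc. split.
      * assert (f (a, b, c) + m * (c' - c) <= f (a, b, c')); [|lra].
        apply Hf2. intros t. specialize (Hf1 (a, b, c) t). simpl in *.
        unfold Rmax in *. repeat destruct Rle_dec; nra.
      * assert (f (a, b, c') - M * (c' - c) <= f (a, b, c)); [|lra].
        apply Hf2. intros t. specialize (Hf1 (a, b, c') t). simpl in *.
        unfold Rmax in *. repeat destruct Rle_dec; nra.
    + intros a b a' b' c.
      assert (f (a, b, c) - L * (Rabs (a - a') + Rabs (b - b')) <= f (a', b', c)); [|lra].
      apply Hf2. intros t. specialize (Hf1 (a, b, c) t). simpl in *.
      pose proof (Rabs_triang (a - a') (a' - x t)). pose proof (Rabs_triang (b - b') (b' - y t)).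
      replace (a - a' + (a' - x t)) with (a - x t) in * by ring.
      replace (b - b' + (b' - y t)) with (b - y t) in * by ring. nra.
  (* At a point of the first curve the competitor [t] itself gives the value [z2 t], and the
     hypothesis [H] says that no competitor [s] gives less. *)
  - intros t. unfold curve3. f_equal. apply Rle_antisym.
    + specialize (Hf1 (x t, y t, z1 t) t). simpl in Hf1.
      rewrite !Rminus_diag, Rabs_R0, !Rmult_0_r, Rmax_left in Hf1 by lra. lra.
    + apply Hf2. intros s. simpl. specialize (H t s). lra.
Qed.

(** * Curves with the same crossings *)

Definition lipschitz (f : R -> R) : Prop :=
  exists C, 0 < C /\ forall s t, Rabs (f s - f t) <= C * Rabs (s - t).

Definition tame (f : R -> R) : Prop :=
  exists C, 0 < C /\ (forall s t, Rabs (f s - f t) <= C * Rabs (s - t)) /\ forall t, Rabs (f t) <= C.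

Definition periodic (f : R -> R) : Prop := forall t, f (t + 2 * PI) = f t.

Definition congr (s t : R) : Prop := exists k : Z, s - t = 2 * PI * IZR k.

Lemma periodic_Z (f : R -> R) (k : Z) (t : R) : periodic f -> f (t + 2 * PI * IZR k) = f t.
Proof.
  intros Hf.
  assert (H : forall (n : nat) u, f (u + 2 * PI * INR n) = f u).
  { induction n as [|n IH]; intros u.
    - simpl. f_equal. ring.
    - rewrite S_INR. replace (u + 2 * PI * (INR n + 1)) with (u + 2 * PI * INR n + 2 * PI) by ring.
      now rewrite Hf. }
  destruct (Z_le_gt_dec 0 k) as [Hk|Hk].
  - rewrite <- (Z2Nat.id k), <- INR_IZR_INZ by lia. apply H.
  - rewrite <- (H (Z.to_nat (- k)) (t + 2 * PI * IZR k)). f_equal.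
    rewrite INR_IZR_INZ, Z2Nat.id, opp_IZR by lia. ring.
Qed.

Lemma euclid_2PI (c t : R) : exists k : Z, c <= t - 2 * PI * IZR k < c + 2 * PI.
Proof.
  pose proof PI_RGT_0. destruct (archimed ((t - c) / (2 * PI))) as [H1 H2].
  exists (up ((t - c) / (2 * PI)) - 1)%Z. rewrite minus_IZR.
  set (u := IZR (up ((t - c) / (2 * PI)))) in *.
  assert (E : (t - c) = (t - c) / (2 * PI) * (2 * PI)) by (field; lra).
  set (v := (t - c) / (2 * PI)) in *. nra.
Qed.

Lemma lipschitz_tame (f : R -> R) : tame f -> lipschitz f.
Proof. intros (C & H1 & H2 & _). now exists C. Qed.

Lemma lipschitz_affine (a b : R) : lipschitz (fun t => a * t + b).
Proof.
  exists (Rabs a + 1). split; [pose proof (Rabs_pos a); lra|]. intros s t.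
  replace (a * s + b - (a * t + b)) with (a * (s - t)) by ring. rewrite Rabs_mult.
  pose proof (Rabs_pos (s - t)). nra.
Qed.

Lemma lipschitz_plus (f g : R -> R) : lipschitz f -> lipschitz g -> lipschitz (fun t => f t + g t).
Proof.
  intros (C & HC & Hf) (D & HD & Hg). exists (C + D). split; [lra|]. intros s t.
  replace (f s + g s - (f t + g t)) with (f s - f t + (g s - g t)) by ring.
  pose proof (Rabs_triang (f s - f t) (g s - g t)). specialize (Hf s t). specialize (Hg s t). lra.
Qed.

Lemma Rabs_sin_le (u : R) : Rabs (sin u) <= Rabs u.
Proof.
  assert (H : forall v, 0 <= v -> Rabs (sin v) <= v).
  { intros v Hv. destruct (Rle_lt_or_eq_dec 0 v Hv) as [H| <-].
    - destruct (Rle_dec v 1) as [H1|H1].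
      + pose proof (sin_lt_x v H). pose proof PI2_1. pose proof (sin_ge_0 v ltac:(lra) ltac:(lra)).
        rewrite Rabs_pos_eq; lra.
      + pose proof (SIN_bound v). apply Rabs_le. lra.
    - rewrite sin_0, Rabs_R0. lra. }
  destruct (Rle_dec 0 u) as [Hu|Hu].
  - rewrite (Rabs_pos_eq u Hu). auto.
  - rewrite <- (Rabs_Ropp u), <- Rabs_Ropp, <- sin_neg, (Rabs_pos_eq (- u)) by lra. apply H. lra.
Qed.

Lemma Rabs_cos_le_1 (u : R) : Rabs (cos u) <= 1.
Proof. pose proof (COS_bound u). apply Rabs_le. lra. Qed.

Lemma Rabs_sin_le_1 (u : R) : Rabs (sin u) <= 1.
Proof. pose proof (SIN_bound u). apply Rabs_le. lra. Qed.

Lemma Rabs_cos_minus_le (u v : R) : Rabs (cos u - cos v) <= Rabs (u - v).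
Proof.
  rewrite form2, !Rabs_mult. replace (Rabs (-2)) with 2 by (rewrite Rabs_left; lra).
  pose proof (Rabs_sin_le ((u - v) / 2)). pose proof (Rabs_sin_le_1 ((u + v) / 2)).
  unfold Rdiv in *. rewrite (Rabs_mult (u - v)) in *.
  replace (Rabs (/ 2)) with (/ 2) in * by (rewrite Rabs_right; lra).
  pose proof (Rabs_pos (sin ((u - v) * / 2))). pose proof (Rabs_pos (sin ((u + v) * / 2))). nra.
Qed.

Lemma tame_cos (f : R -> R) : lipschitz f -> tame (fun t => cos (f t)).
Proof.
  intros (C & HC & Hf). exists (C + 1). split; [lra|]. split.
  - intros s t. pose proof (Rabs_cos_minus_le (f s) (f t)). specialize (Hf s t).
    pose proof (Rabs_pos (s - t)). lra.
  - intros t. pose proof (Rabs_cos_le_1 (f t)). lra.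
Qed.

Lemma tame_ext (f g : R -> R) : (forall t, f t = g t) -> tame f -> tame g.
Proof.
  intros E (C & HC & H1 & H2). exists C. split; [lra|].
  split; intros; rewrite <- !E; auto.
Qed.

Lemma tame_sin (f : R -> R) : lipschitz f -> tame (fun t => sin (f t)).
Proof.
  intros Hf. apply (tame_ext (fun t => cos (f t + - (PI / 2)))).
  - intros t. rewrite <- (cos_shift (f t)), <- cos_neg. f_equal. ring.
  - apply tame_cos. apply lipschitz_plus; auto.
    exists 1. split; [lra|]. intros s t. rewrite Rminus_diag, Rabs_R0. pose proof (Rabs_pos (s - t)). lra.
Qed.

Lemma tame_const (c : R) : tame (fun _ => c).
Proof.
  exists (Rabs c + 1). pose proof (Rabs_pos c). split; [lra|]. split; [|intros; lra].
  intros s t. rewrite Rminus_diag, Rabs_R0. pose proof (Rabs_pos (s - t)). nra.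
Qed.

Lemma tame_plus (f g : R -> R) : tame f -> tame g -> tame (fun t => f t + g t).
Proof.
  intros (C & HC & Hf & Bf) (D & HD & Hg & Bg). exists (C + D). split; [lra|]. split.
  - intros s t.
    replace (f s + g s - (f t + g t)) with (f s - f t + (g s - g t)) by ring.
    pose proof (Rabs_triang (f s - f t) (g s - g t)). specialize (Hf s t). specialize (Hg s t). lra.
  - intros t. pose proof (Rabs_triang (f t) (g t)). specialize (Bf t). specialize (Bg t). lra.
Qed.

Lemma tame_mult (f g : R -> R) : tame f -> tame g -> tame (fun t => f t * g t).
Proof.
  intros (C & HC & Hf & Bf) (D & HD & Hg & Bg). exists (2 * C * D). split; [nra|]. split.
  - intros s t.
    replace (f s * g s - f t * g t) with ((f s - f t) * g s + f t * (g s - g t)) by ring.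
    eapply Rle_trans; [apply Rabs_triang|]. rewrite !Rabs_mult.
    pose proof (Rmult_le_compat _ _ _ _ (Rabs_pos _) (Rabs_pos _) (Hf s t) (Bg s)).
    pose proof (Rmult_le_compat _ _ _ _ (Rabs_pos _) (Rabs_pos _) (Bf t) (Hg s t)). lra.
  - intros t. rewrite Rabs_mult.
    pose proof (Rmult_le_compat _ _ _ _ (Rabs_pos _) (Rabs_pos _) (Bf t) (Bg t)). nra.
Qed.

(** * Uniform lower bounds by compactness *)

Lemma box_lower_bound (G : R -> R -> R) (a b a' b' C : R) :
  0 < C ->
  (forall x y u v, Rabs (G x y - G u v) <= C * (Rabs (x - u) + Rabs (y - v))) ->
  (forall x y, a <= x <= b -> a' <= y <= b' -> 0 < G x y) ->
  exists eps, 0 < eps /\ forall x y, a <= x <= b -> a' <= y <= b' -> eps <= G x y.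
Proof.
  intros HC HG Hpos. assert (H4C : 0 < 4 * C) by lra.
  (* This gauge is so small that [G] keeps at least half of its value [G u v] on the square of
     radius [d u v]. Where [G] is not positive, which does not happen in the box, the gauge takes
     the arbitrary value 1. *)
  set (d := fun u v => match Rlt_dec 0 (G u v) with
                       | left H => mkposreal (G u v / (4 * C)) (Rdiv_lt_0_compat _ _ H H4C)
                       | right _ => mkposreal 1 Rlt_0_1 end).
  destruct (compactness_value_2d a b a' b' d) as [e He].
  (* The tagged point satisfies [e <= d u v], so [G x y >= G u v - 2 * C * d u v = 2 * C * d u v >=
     2 * C * e]. The compactness lemma yields the tag only under a double negation, whence
     [NNPP]. *)
  exists (2 * C * e). pose proof (cond_pos e). split; [nra|].
  intros x y Hx Hy. apply NNPP. intros N. apply (He x y Hx Hy).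
  intros (u & v & Hu & Hv & H1 & H2 & H3). apply N.
  unfold d in *. destruct (Rlt_dec 0 (G u v)) as [P|P]; [|destruct P; auto].
  simpl in *. pose proof (HG u v x y) as H4.
  rewrite (Rabs_minus_sym u), (Rabs_minus_sym v) in H4.
  pose proof (Rle_abs (G u v - G x y)).
  assert (E : C * (G u v / (4 * C)) = G u v / 4) by (field; lra).
  set (w := G u v / (4 * C)) in *. nra.
Qed.

(** Periodicity in each variable reduces the claim to a compact box of pairs whose difference stays
    [delta] away from the multiples of [2 * PI], where [G] is positive. *)
Lemma off_diagonal_bound (G : R -> R -> R) (C delta : R) :
  0 < C -> 0 < delta < PI ->
  (forall x y u v, Rabs (G x y - G u v) <= C * (Rabs (x - u) + Rabs (y - v))) ->
  (forall t, periodic (fun s => G s t)) -> (forall s, periodic (G s)) ->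
  (forall s t, ~ congr s t -> 0 < G s t) ->
  exists eps, 0 < eps /\ forall s t,
    (exists k : Z, Rabs (s - t - 2 * PI * IZR k) <= delta) \/ eps <= G s t.
Proof.
  intros HC Hd HG P1 P2 Hpos. pose proof PI_RGT_0.
  (* The coordinates are [t] and the difference [b = s - t]. The range [[delta, 2 * PI - delta]] of
     [b] contains no multiple of [2 * PI]. *)
  destruct (box_lower_bound (fun t b => G (t + b) t) 0 (2 * PI) delta (2 * PI - delta) (2 * C))
    as (eps & He & Hb); [lra| | |].
  - intros x y u v. eapply Rle_trans; [apply HG|].
    pose proof (Rabs_triang (x - u) (y - v)).
    replace (x - u + (y - v)) with (x + y - (u + v)) in * by ring.
    pose proof (Rabs_pos (y - v)). nra.
  - intros t b Ht Hb. apply Hpos. intros [k Hk].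
    replace (t + b - t) with b in Hk by ring.
    assert (0 < IZR k) by nra. assert (IZR k < 1) by nra.
    apply lt_IZR in H0. apply lt_IZR in H1. lia.
  - exists eps. split; [lra|]. intros s t.
    destruct (euclid_2PI (- delta) (s - t)) as [k Hk].
    destruct (Rle_dec (s - t - 2 * PI * IZR k) delta) as [Hl|Hl].
    { left. exists k. apply Rabs_le. lra. }
    right. destruct (euclid_2PI 0 t) as [l Hl'].
    specialize (Hb (t - 2 * PI * IZR l) (s - t - 2 * PI * IZR k) ltac:(lra) ltac:(lra)).
    simpl in Hb.
    rewrite <- (periodic_Z (G s) (- l)%Z t (P2 s)).
    rewrite <- (periodic_Z (fun s => G s _) (- l - k)%Z s (P1 _)).
    rewrite minus_IZR, opp_IZR in *.
    replace (s + 2 * PI * (- IZR l - IZR k)) with (t - 2 * PI * IZR l + (s - t - 2 * PI * IZR k)) by ring.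
    replace (t + 2 * PI * - IZR l) with (t - 2 * PI * IZR l) by ring. exact Hb.
Qed.

(** A quantitative form of being an immersion: nearby parameters are separated by the planar curve
    at a linear rate, so there are no double points close to the diagonal. *)
Definition regular (x w : R -> R) : Prop :=
  exists delta kappa, 0 < delta < PI /\ 0 < kappa /\
    forall s t, Rabs (s - t) <= delta -> kappa * Rabs (s - t) <= Rabs (x s - x t) + Rabs (w s - w t).

Lemma mean_value (f df : R -> R) (s t : R) :
  (forall u, is_derive f u (df u)) ->
  exists c, Rabs (c - t) <= Rabs (s - t) /\ Rabs (f s - f t) = Rabs (df c) * Rabs (s - t).
Proof.
  intros H. destruct (MVT_gen f t s df) as (c & Hc & E).
  - intros u _. apply H.
  - intros u _. apply continuity_pt_filterlim, (ex_derive_continuous f u). eexists; apply H.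
  - exists c. split.
    + unfold Rmin, Rmax in Hc. destruct (Rle_dec t s) as [Hs|Hs].
      * rewrite !Rabs_pos_eq; lra.
      * rewrite !Rabs_left1; lra.
    + now rewrite E, Rabs_mult.
Qed.

(** The sum [|dx| + |dw|] is positive and periodic, hence bounded below by some [eps]. The mean
    value theorem gives different intermediate points for [x] and [w], but moving both to [t] costs
    at most half of [eps] when [delta] is small. *)
Lemma regular_of_derive (x w dx dw : R -> R) :
  (forall t, is_derive x t (dx t)) -> (forall t, is_derive w t (dw t)) ->
  lipschitz dx -> lipschitz dw -> periodic dx -> periodic dw ->
  (forall t, dx t = 0 -> dw t <> 0) -> regular x w.
Proof.
  intros Hx Hw (C & HC & Lx) (D & HD & Lw) Px Pw H0. pose proof PI_RGT_0.
  (* A one-variable bound, obtained from the box lemma with the degenerate second side [[0, 0]]. *)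
  destruct (box_lower_bound (fun t _ => Rabs (dx t) + Rabs (dw t)) 0 (2 * PI) 0 0 (C + D))
    as (eps & He & Hb); [lra| | |].
  - intros t a u b. specialize (Lx t u). specialize (Lw t u).
    pose proof (Rabs_triang_inv2 (dx t) (dx u)). pose proof (Rabs_triang_inv2 (dw t) (dw u)).
    pose proof (Rabs_triang (Rabs (dx t) - Rabs (dx u)) (Rabs (dw t) - Rabs (dw u))).
    replace (Rabs (dx t) - Rabs (dx u) + (Rabs (dw t) - Rabs (dw u)))
      with (Rabs (dx t) + Rabs (dw t) - (Rabs (dx u) + Rabs (dw u))) in * by ring.
    pose proof (Rabs_pos (a - b)). nra.
  - intros t _ _ _. pose proof (Rabs_pos (dx t)). pose proof (Rabs_pos (dw t)).
    destruct (Req_dec (dx t) 0) as [E|E].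
    + pose proof (Rabs_pos_lt _ (H0 t E)). lra.
    + pose proof (Rabs_pos_lt _ E). lra.
  - assert (Hb' : forall t, eps <= Rabs (dx t) + Rabs (dw t)).
    { intros t. destruct (euclid_2PI 0 t) as [k Hk].
      specialize (Hb (t - 2 * PI * IZR k) 0 ltac:(lra) ltac:(lra)). simpl in Hb.
      replace (t - 2 * PI * IZR k) with (t + 2 * PI * IZR (- k)) in Hb by (rewrite opp_IZR; ring).
      now rewrite (periodic_Z dx), (periodic_Z dw) in Hb by auto. }
    set (delta := Rmin 1 (eps / (2 * (C + D)))).
    assert (Hd1 : delta <= 1) by apply Rmin_l.
    assert (Hd2 : delta <= eps / (2 * (C + D))) by apply Rmin_r.
    assert (Hd0 : 0 < delta) by (apply Rmin_glb_lt; [lra|apply Rdiv_lt_0_compat; lra]).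
    assert (Hd3 : delta * (C + D) <= eps / 2).
    { replace (eps / 2) with (eps / (2 * (C + D)) * (C + D)) by (field; lra). nra. }
    exists delta, (eps / 2). pose proof PI2_1. split; [lra|]. split; [lra|].
    intros s t Hst.
    destruct (mean_value x dx s t Hx) as (c & Hc & ->).
    destruct (mean_value w dw s t Hw) as (d & Hd & ->).
    specialize (Lx c t). specialize (Lw d t). specialize (Hb' t).
    pose proof (Rabs_triang_inv2 (dx c) (dx t)). pose proof (Rabs_triang_inv2 (dw d) (dw t)).
    pose proof (Rle_abs (-(Rabs (dx c) - Rabs (dx t)))). pose proof (Rle_abs (-(Rabs (dw d) - Rabs (dw t)))).
    rewrite Rabs_Ropp in *.
    pose proof (Rabs_pos (s - t)).
    rewrite <- Rmult_plus_distr_r. apply Rmult_le_compat_r; [lra|]. nra.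
Qed.

Lemma Rmax_lipschitz (a b c d : R) : Rabs (Rmax a b - Rmax c d) <= Rabs (a - c) + Rabs (b - d).
Proof.
  pose proof (Rle_abs (a - c)). pose proof (Rle_abs (b - d)).
  pose proof (Rle_abs (- (a - c))). pose proof (Rle_abs (- (b - d))). rewrite !Rabs_Ropp in *.
  apply Rabs_le. unfold Rmax. repeat destruct Rle_dec; lra.
Qed.

Lemma Rabs_minus_lipschitz (f : R -> R) (C s t u v : R) :
  (forall s t, Rabs (f s - f t) <= C * Rabs (s - t)) ->
  Rabs (f s - f t - (f u - f v)) <= C * (Rabs (s - u) + Rabs (t - v)).
Proof.
  intros H. replace (f s - f t - (f u - f v)) with (f s - f u + - (f t - f v)) by ring.
  eapply Rle_trans; [apply Rabs_triang|]. rewrite Rabs_Ropp.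
  pose proof (H s u). pose proof (H t v). lra.
Qed.

Lemma regular_congr (x w : R -> R) :
  regular x w -> periodic x -> periodic w ->
  exists delta kappa, 0 < delta < PI /\ 0 < kappa /\
    forall s t k, Rabs (s - t - 2 * PI * IZR k) <= delta ->
      kappa * Rabs (s - t - 2 * PI * IZR k) <= Rabs (x s - x t) + Rabs (w s - w t).
Proof.
  intros (delta & kappa & Hd & Hk & H) Px Pw. exists delta, kappa. split; [exact Hd|]. split; [exact Hk|].
  intros s t k Hs. specialize (H s (t + 2 * PI * IZR k)).
  rewrite (periodic_Z x), (periodic_Z w) in H by auto.
  replace (s - (t + 2 * PI * IZR k)) with (s - t - 2 * PI * IZR k) in H by ring. auto.
Qed.

(** * Crossing signs determine the curve up to homeomorphism *)

(** The inequality required by [carries_vertical] is in danger only where the planar distance is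
    small, [z1 s - z1 t] is not clearly positive and [z2 s - z2 t] is not clearly negative.
    Agreement of signs at double points and compactness exclude this away from the diagonal;
    regularity handles the neighbourhood of the diagonal. *)
Lemma carries_same_crossings (x w z1 z2 : R -> R) :
  tame x -> tame w -> tame z1 -> tame z2 ->
  periodic x -> periodic w -> periodic z1 -> periodic z2 -> regular x w ->
  (forall s t, ~ congr s t -> x s = x t -> w s = w t -> 0 < (z1 s - z1 t) * (z2 s - z2 t)) ->
  carries (curve3 x w z1) (curve3 x w z2).
Proof.
  intros (Cx & HCx & Lx & _) (Cw & HCw & Lw & _) (C1 & HC1 & L1 & B1) (C2 & HC2 & L2 & B2)
    Px Pw P1 P2 HR Hsign.
  destruct (regular_congr x w HR Px Pw) as (delta & kappa & Hd & Hk & Hreg).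
  set (P := fun s t => Rabs (x s - x t) + Rabs (w s - w t)).
  (* [G] vanishes exactly in the dangerous situation: a double point with [z1 s <= z1 t] and
     [z2 s >= z2 t]. *)
  set (G := fun s t => P s t + Rmax 0 (Rmax (z1 s - z1 t) (- (z2 s - z2 t)))).
  assert (HP : forall s t, 0 <= P s t).
  { intros s t. unfold P. pose proof (Rabs_pos (x s - x t)). pose proof (Rabs_pos (w s - w t)). lra. }
  destruct (off_diagonal_bound G (Cx + Cw + C1 + C2) delta) as (eps & He & Hoff); [lra|lra| | | | |].
  - intros s t u v. unfold G, P.
    pose proof (Rabs_minus_lipschitz x Cx s t u v Lx). pose proof (Rabs_minus_lipschitz w Cw s t u v Lw).
    pose proof (Rabs_minus_lipschitz z1 C1 s t u v L1). pose proof (Rabs_minus_lipschitz z2 C2 s t u v L2).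
    pose proof (Rabs_triang_inv2 (x s - x t) (x u - x v)). pose proof (Rabs_triang_inv2 (w s - w t) (w u - w v)).
    pose proof (Rmax_lipschitz 0 (Rmax (z1 s - z1 t) (- (z2 s - z2 t))) 0 (Rmax (z1 u - z1 v) (- (z2 u - z2 v)))) as M1.
    pose proof (Rmax_lipschitz (z1 s - z1 t) (- (z2 s - z2 t)) (z1 u - z1 v) (- (z2 u - z2 v))) as M2.
    rewrite Rminus_diag, Rabs_R0 in M1.
    replace (- (z2 s - z2 t) - - (z2 u - z2 v)) with (- (z2 s - z2 t - (z2 u - z2 v))) in M2 by ring.
    rewrite Rabs_Ropp in M2.
    match goal with |- Rabs (?a + ?b + ?c - (?a' + ?b' + ?c')) <= _ =>
      replace (a + b + c - (a' + b' + c')) with (a - a' + (b - b') + (c - c')) by ring;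
      pose proof (Rabs_triang (a - a' + (b - b')) (c - c')); pose proof (Rabs_triang (a - a') (b - b')) end.
    lra.
  - intros t s. unfold G, P. now rewrite Px, Pw, P1, P2.
  - intros s t. unfold G, P. now rewrite Px, Pw, P1, P2.
  - intros s t Hst. unfold G.
    pose proof (Rmax_l 0 (Rmax (z1 s - z1 t) (- (z2 s - z2 t)))).
    destruct (Rle_lt_or_eq_dec _ _ (HP s t)) as [Hp|Hp]; [lra|]. unfold P in *.
    assert (Ex : x s = x t).
    { apply NNPP. intros N. pose proof (Rabs_pos_lt (x s - x t) ltac:(lra)). pose proof (Rabs_pos (w s - w t)). lra. }
    assert (Ew : w s = w t).
    { apply NNPP. intros N. pose proof (Rabs_pos_lt (w s - w t) ltac:(lra)). pose proof (Rabs_pos (x s - x t)). lra. }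
    specialize (Hsign s t Hst Ex Ew). rewrite <- Hp.
    pose proof (Rmax_r 0 (Rmax (z1 s - z1 t) (- (z2 s - z2 t)))).
    pose proof (Rmax_l (z1 s - z1 t) (- (z2 s - z2 t))). pose proof (Rmax_r (z1 s - z1 t) (- (z2 s - z2 t))).
    destruct (Rlt_dec 0 (z1 s - z1 t)); [lra|]. assert (z2 s - z2 t < 0) by nra. lra.
  - set (C := C1 + C2).
    assert (HC : 0 < C) by (unfold C; lra).
    assert (Bz : forall s t, Rabs (z1 s - z1 t) <= 2 * C /\ Rabs (z2 s - z2 t) <= 2 * C).
    { intros s t. unfold C. pose proof (Rabs_triang (z1 s) (- z1 t)). pose proof (Rabs_triang (z2 s) (- z2 t)).
      rewrite !Rabs_Ropp in *. pose proof (B1 s). pose proof (B1 t). pose proof (B2 s). pose proof (B2 t).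
      unfold Rminus. lra. }
    (* The constants are tuned to height differences of size at most [2 * C]: [m] so that
       [m * (2 * C) <= eps / 2], [M] so that [M * (eps / 2) >= 2 * C], [La] against the separation
       rate [kappa], and [Lb] so that a planar distance of [eps / 2] contributes [4 * C]. *)
    set (m := eps / (4 * C + eps)).
    assert (Em : m * (4 * C + eps) = eps) by (unfold m; field; lra).
    assert (Hm : 0 < m) by (apply Rdiv_lt_0_compat; lra).
    assert (Hm1 : m <= 1) by nra.
    set (M := 1 + 4 * C / eps).
    assert (EM : M * eps = eps + 4 * C) by (unfold M; field; lra).
    set (La := 2 * C / kappa). set (Lb := 8 * C / eps).
    assert (ELa : La * kappa = 2 * C) by (unfold La; field; lra).
    assert (ELb : Lb * eps = 8 * C) by (unfold Lb; field; lra).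
    assert (HLa : 0 < La) by (apply Rdiv_lt_0_compat; lra).
    assert (HLb : 0 < Lb) by (apply Rdiv_lt_0_compat; lra).
    apply (carries_vertical x w z1 z2 m M (La + Lb) C); auto; try lra.
    + assert (0 < 4 * C / eps) by (apply Rdiv_lt_0_compat; lra). unfold M. lra.
    + intros t. specialize (B1 t). unfold C. lra.
    + intros t. specialize (B2 t). unfold C. lra.
    + intros s t. fold (P s t). specialize (HP s t). specialize (Bz s t).
      destruct Bz as [Bz1 Bz2]. apply Rabs_le_between in Bz1. apply Rabs_le_between in Bz2.
      set (D1 := z1 s - z1 t) in *. set (D2 := z2 s - z2 t) in *.
      pose proof (Rmax_l (M * D1) (m * D1)). pose proof (Rmax_r (M * D1) (m * D1)).
      assert (0 <= La * P s t) by nra. assert (0 <= Lb * P s t) by nra.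
      rewrite Rmult_plus_distr_r.
      (* Near the diagonal [La] times the planar distance pays for both height differences. Away
         from it the planar distance, [D1] or [- D2] is at least [eps / 2], and [Lb], [M] or [m]
         respectively settles the inequality. *)
      destruct (Hoff s t) as [[k Hk']|HG].
      * specialize (Hreg s t k Hk'). fold (P s t) in Hreg.
        assert (HD : Rabs D1 <= C * Rabs (s - t - 2 * PI * IZR k) /\ Rabs D2 <= C * Rabs (s - t - 2 * PI * IZR k)).
        { pose proof (L1 s (t + 2 * PI * IZR k)) as E1. pose proof (L2 s (t + 2 * PI * IZR k)) as E2.
          rewrite (periodic_Z z1) in E1 by auto. rewrite (periodic_Z z2) in E2 by auto.
          replace (s - (t + 2 * PI * IZR k)) with (s - t - 2 * PI * IZR k) in * by ring.
          pose proof (Rabs_pos (s - t - 2 * PI * IZR k)). unfold C, D1, D2. nra. }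
        destruct HD as [HD1 HD2]. apply Rabs_le_between in HD1. apply Rabs_le_between in HD2.
        set (e := Rabs (s - t - 2 * PI * IZR k)) in *.
        assert (0 <= e) by apply Rabs_pos.
        assert (2 * C * e <= La * P s t) by (rewrite <- ELa; nra).
        assert (- (C * e) <= m * D1) by nra. lra.
      * unfold G in HG. fold D1 D2 in HG.
        destruct (Rle_dec (eps / 2) (P s t)) as [Hp|Hp].
        { assert (4 * C <= Lb * P s t) by nra. assert (- (2 * C) <= m * D1) by nra. lra. }
        destruct (Rle_dec (eps / 2) D1) as [Hp1|Hp1].
        { assert (2 * C <= M * D1) by nra. lra. }
        assert (D2 <= - (eps / 2)).
        { revert HG. unfold Rmax. repeat destruct Rle_dec; lra. }
        assert (- (eps / 2) <= m * D1) by nra. lra.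
Qed.

(** By compactness the heights at all double points differ by a uniform [eps], so moving each height
    by less than [eps / 2] preserves every crossing sign. *)
Lemma carries_perturb (x w z : R -> R) :
  tame x -> tame w -> tame z -> periodic x -> periodic w -> periodic z -> regular x w ->
  (forall s t, ~ congr s t -> x s = x t -> w s = w t -> z s <> z t) ->
  exists eps, 0 < eps /\ forall z', tame z' -> periodic z' ->
    (forall t, Rabs (z' t - z t) < eps) -> carries (curve3 x w z) (curve3 x w z').
Proof.
  intros Tx Tw Tz Px Pw Pz HR Hemb.
  destruct (regular_congr x w HR Px Pw) as (delta & kappa & Hd & Hk & Hreg).
  destruct Tx as (Cx & HCx & Lx & Bx) eqn:ETx; destruct Tw as (Cw & HCw & Lw & Bw) eqn:ETw;
  destruct Tz as (Cz & HCz & Lz & Bz) eqn:ETz.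
  destruct (off_diagonal_bound
    (fun s t => Rabs (x s - x t) + Rabs (w s - w t) + Rabs (z s - z t)) (Cx + Cw + Cz) delta)
    as (eps & He & Hoff); [lra|lra| | | | |].
  - intros s t u v.
    pose proof (Rabs_minus_lipschitz x Cx s t u v Lx). pose proof (Rabs_minus_lipschitz w Cw s t u v Lw).
    pose proof (Rabs_minus_lipschitz z Cz s t u v Lz).
    pose proof (Rabs_triang_inv2 (x s - x t) (x u - x v)). pose proof (Rabs_triang_inv2 (w s - w t) (w u - w v)).
    pose proof (Rabs_triang_inv2 (z s - z t) (z u - z v)).
    match goal with |- Rabs (?a + ?b + ?c - (?a' + ?b' + ?c')) <= _ =>
      replace (a + b + c - (a' + b' + c')) with (a - a' + (b - b') + (c - c')) by ring;
      pose proof (Rabs_triang (a - a' + (b - b')) (c - c')); pose proof (Rabs_triang (a - a') (b - b')) end.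
    lra.
  - intros t s. now rewrite Px, Pw, Pz.
  - intros s t. now rewrite Px, Pw, Pz.
  - intros s t Hst.
    pose proof (Rabs_pos (x s - x t)). pose proof (Rabs_pos (w s - w t)). pose proof (Rabs_pos (z s - z t)).
    destruct (Req_dec (x s) (x t)) as [Ex|N]; [|pose proof (Rabs_pos_lt (x s - x t) ltac:(lra)); lra].
    destruct (Req_dec (w s) (w t)) as [Ew|N]; [|pose proof (Rabs_pos_lt (w s - w t) ltac:(lra)); lra].
    specialize (Hemb s t Hst Ex Ew). pose proof (Rabs_pos_lt (z s - z t) ltac:(lra)). lra.
  - exists (eps / 2). split; [lra|]. intros z' Tz' Pz' Hz'.
    apply carries_same_crossings; auto.
    intros s t Hst Ex Ew. destruct (Hoff s t) as [[k Hk']|HG].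
    + exfalso. apply Hst. exists k. specialize (Hreg s t k Hk').
      rewrite Ex, Ew, !Rminus_diag, Rabs_R0 in Hreg.
      apply NNPP. intros N. pose proof (Rabs_pos_lt (s - t - 2 * PI * IZR k) ltac:(lra)). nra.
    + rewrite Ex, Ew, !Rminus_diag, Rabs_R0 in HG.
      pose proof (proj1 (Rabs_lt_between _ _) (Hz' s)). pose proof (proj1 (Rabs_lt_between _ _) (Hz' t)).
      unfold Rabs in HG. destruct Rcase_abs in HG.
      * assert (z' s - z' t < 0) by lra. nra.
      * assert (0 < z' s - z' t) by lra. assert (0 < z s - z t) by lra. nra.
Qed.

(** * The twisted family *)

Lemma sin_shift_2PI (k : Z) (u : R) : sin (u + 2 * PI * IZR k) = sin u.
Proof. apply (periodic_Z sin). intros t. rewrite sin_plus, sin_2PI, cos_2PI. ring. Qed.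

Lemma cos_shift_2PI (k : Z) (u : R) : cos (u + 2 * PI * IZR k) = cos u.
Proof. apply (periodic_Z cos). intros t. rewrite cos_plus, sin_2PI, cos_2PI. ring. Qed.

Lemma shift_PI (k : Z) : exists e, (e = 1 \/ e = -1) /\
  forall u, sin (u + IZR k * PI) = e * sin u /\ cos (u + IZR k * PI) = e * cos u.
Proof.
  destruct (Z.Even_or_Odd k) as [[l ->]|[l ->]].
  - exists 1. split; [auto|]. intros u. rewrite mult_IZR.
    replace (u + 2 * IZR l * PI) with (u + 2 * PI * IZR l) by ring.
    rewrite sin_shift_2PI, cos_shift_2PI. lra.
  - exists (-1). split; [auto|]. intros u. rewrite plus_IZR, mult_IZR.
    replace (u + (2 * IZR l + 1) * PI) with (u + PI + 2 * PI * IZR l) by ring.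
    rewrite sin_shift_2PI, cos_shift_2PI, neg_sin, neg_cos. lra.
Qed.

Lemma cos_minus_half (u v A B : R) :
  u = A + B -> v = A - B -> cos u - cos v = -2 * sin B * sin A.
Proof. intros -> ->. rewrite form2. do 2 f_equal; [f_equal|]; f_equal; field. Qed.

Lemma cos_eq_cases (u v : R) : cos u = cos v -> sin ((u - v) / 2) = 0 \/ sin ((u + v) / 2) = 0.
Proof. intros H. pose proof (form2 u v). rewrite H, Rminus_diag in *. apply Rmult_integral. lra. Qed.

(* The [sin^2] term vanishes at the double points of the first kind and equals [c sin^2 (p phi)] at
   those of the second kind, so that [psi] and [c] control both kinds independently. *)
Definition wave (p q n : Z) (psi c t : R) : R :=
  cos (IZR n * t + psi + c * (sin (IZR p * IZR q * t) * sin (IZR p * IZR q * t))).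

Definition twisted (p q n : Z) (phi psi c : R) : curve :=
  curve3 (fun t => cos (IZR p * t)) (fun t => cos (IZR q * t + phi)) (wave p q n psi c).

Lemma tame_cos_affine (a b : R) : tame (fun t => cos (a * t + b)).
Proof. apply tame_cos, lipschitz_affine. Qed.

Lemma tame_cos_linear (a : R) : tame (fun t => cos (a * t)).
Proof. apply (tame_ext (fun t => cos (a * t + 0))); [intros; f_equal; ring|apply tame_cos_affine]. Qed.

Lemma tame_sin_linear (a : R) : tame (fun t => sin (a * t)).
Proof.
  apply (tame_ext (fun t => sin (a * t + 0))); [intros; f_equal; ring|].
  apply tame_sin, lipschitz_affine.
Qed.

Lemma lipschitz_wave_phase (N n psi c : R) :
  lipschitz (fun t => n * t + psi + c * (sin (N * t) * sin (N * t))).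
Proof.
  apply lipschitz_plus; [apply lipschitz_affine|]. apply lipschitz_tame.
  apply tame_mult; [apply tame_const|]. apply tame_mult; apply tame_sin_linear.
Qed.

Lemma tame_wave (p q n : Z) (psi c : R) : tame (wave p q n psi c).
Proof. apply tame_cos, lipschitz_wave_phase. Qed.

Lemma periodic_cos_affine (n : Z) (b : R) : periodic (fun t => cos (IZR n * t + b)).
Proof.
  intros t. rewrite <- (cos_shift_2PI n (IZR n * t + b)). f_equal. ring.
Qed.

Lemma periodic_cos_linear (n : Z) : periodic (fun t => cos (IZR n * t)).
Proof. intros t. rewrite <- (cos_shift_2PI n (IZR n * t)). f_equal. ring. Qed.

Lemma periodic_sin_linear (n : Z) : periodic (fun t => sin (IZR n * t)).
Proof. intros t. rewrite <- (sin_shift_2PI n (IZR n * t)). f_equal. ring. Qed.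

Lemma periodic_wave (p q n : Z) (psi c : R) : periodic (wave p q n psi c).
Proof.
  intros t. unfold wave. rewrite <- mult_IZR.
  rewrite (periodic_sin_linear (p * q) t).
  rewrite <- (cos_shift_2PI n (IZR n * t + _ + _)). f_equal. ring.
Qed.

(** The condition that [a] and [a'] lie in the same open unit interval between integers, modulo
    [2 * N], in the form in which crossing signs use it. For [N > 0], [same_cell N a a] just says
    that [a] is not an integer. *)
Definition same_cell (N : Z) (a a' : R) : Prop :=
  forall m : Z, 0 < sin (PI * (IZR m + a) / IZR N) * sin (PI * (IZR m + a') / IZR N).

(** Write [m + i = N * d + r] with [0 <= r < N]. Removing [N * d] brings both arguments into
    [(0, N)], where the sine is positive; this costs the same sign on both sides, and the extra
    [2 * N * l] is a full period. *)
Lemma same_cell_of_floor (N i l : Z) (a a' : R) :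
  (0 < N)%Z -> IZR i < a < IZR i + 1 -> IZR i + 2 * IZR N * IZR l < a' < IZR i + 1 + 2 * IZR N * IZR l ->
  same_cell N a a'.
Proof.
  intros HN Ha Ha' m. pose proof PI_RGT_0.
  assert (HN' : 0 < IZR N) by (apply (IZR_lt 0); lia).
  pose proof (Z.div_mod (m + i) N ltac:(lia)) as E. pose proof (Z.mod_pos_bound (m + i) N HN) as Hr.
  set (d := ((m + i) / N)%Z) in *. set (r := ((m + i) mod N)%Z) in *.
  assert (E' : IZR m + IZR i = IZR N * IZR d + IZR r) by (rewrite <- plus_IZR, E, plus_IZR, mult_IZR; auto).
  assert (Hr0 : 0 <= IZR r) by (apply IZR_le; lia).
  assert (Hr1 : IZR r + 1 <= IZR N) by (rewrite <- plus_IZR; apply IZR_le; lia).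
  destruct (shift_PI d) as (e & He & Hs).
  assert (S : forall v, 0 < v < IZR N -> 0 < sin (PI * v / IZR N)).
  { intros v Hv. apply sin_gt_0.
    - apply Rdiv_lt_0_compat; nra.
    - apply (Rmult_lt_reg_r (IZR N)); [lra|]. unfold Rdiv. rewrite Rmult_assoc, Rinv_l by lra. nra. }
  replace (PI * (IZR m + a) / IZR N) with (PI * (IZR m + a - IZR N * IZR d) / IZR N + IZR d * PI)
    by (field; lra).
  replace (PI * (IZR m + a') / IZR N)
    with (PI * (IZR m + a' - IZR N * IZR d - 2 * IZR N * IZR l) / IZR N + IZR d * PI + 2 * PI * IZR l)
    by (field; lra).
  rewrite sin_shift_2PI, !(proj1 (Hs _)).
  pose proof (S (IZR m + a - IZR N * IZR d) ltac:(lra)).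
  pose proof (S (IZR m + a' - IZR N * IZR d - 2 * IZR N * IZR l) ltac:(lra)).
  destruct He as [->| ->]; nra.
Qed.

(* Up to a nonzero factor, the height difference at a double point of the first (second) kind is
   sin (PI (m + level1) / p), respectively sin (PI (m + level2) / q), for some integer m. *)
Definition level1 (p : Z) (psi : R) : R := IZR p * psi / PI.

Definition level2 (p q n : Z) (phi psi c : R) : R :=
  (IZR q * psi + IZR q * c * (sin (IZR p * phi) * sin (IZR p * phi)) - IZR n * phi) / PI.

(** Both [p * q * s] and [p * q * t] are multiples of [PI], so the twist disappears and the product
    formula for a difference of cosines applies to the half-sum and half-difference. *)
Lemma wave_minus_kind1 (p q n j k : Z) (psi c s t : R) :
  (0 < p)%Z -> (0 < q)%Z ->
  (s + t) / 2 = PI * IZR j / IZR p -> (s - t) / 2 = PI * IZR k / IZR q ->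
  wave p q n psi c s - wave p q n psi c t
    = -2 * sin (PI * IZR (n * k) / IZR q) * sin (PI * (IZR (n * j) + level1 p psi) / IZR p).
Proof.
  intros Hp Hq HA HB. apply IZR_lt in Hp. apply IZR_lt in Hq. pose proof PI_RGT_0.
  unfold wave.
  assert (Z0 : forall m : Z, sin (IZR m * PI) = 0) by (intros m; apply sin_eq_0_1; now exists m).
  replace (IZR p * IZR q * s) with (IZR (q * j + p * k) * PI).
  2:{ replace s with ((s + t) / 2 + (s - t) / 2) by field. rewrite HA, HB, plus_IZR, !mult_IZR. field; lra. }
  replace (IZR p * IZR q * t) with (IZR (q * j - p * k) * PI).
  2:{ replace t with ((s + t) / 2 - (s - t) / 2) by field. rewrite HA, HB, minus_IZR, !mult_IZR. field; lra. }
  rewrite !Z0. apply cos_minus_half; rewrite !mult_IZR; unfold level1.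
  - replace s with ((s + t) / 2 + (s - t) / 2) by field. rewrite HA, HB. field; lra.
  - replace t with ((s + t) / 2 - (s - t) / 2) by field. rewrite HA, HB. field; lra.
Qed.

(** Here [p * q * s] and [p * q * t] are both [- p * phi] modulo [PI], so the twist adds the same
    constant [c * sin^2 (p * phi)] to both phases. This constant is the [c] term of [level2]. *)
Lemma wave_minus_kind2 (p q n j k : Z) (phi psi c s t : R) :
  (0 < p)%Z -> (0 < q)%Z ->
  (s + t) / 2 = (PI * IZR j - phi) / IZR q -> (s - t) / 2 = PI * IZR k / IZR p ->
  wave p q n psi c s - wave p q n psi c t
    = -2 * sin (PI * IZR (n * k) / IZR p) * sin (PI * (IZR (n * j) + level2 p q n phi psi c) / IZR q).
Proof.
  intros Hp Hq HA HB. apply IZR_lt in Hp. apply IZR_lt in Hq. pose proof PI_RGT_0.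
  unfold wave.
  assert (Z0 : forall m : Z, sin (- (IZR p * phi) + IZR m * PI) * sin (- (IZR p * phi) + IZR m * PI)
                 = sin (IZR p * phi) * sin (IZR p * phi)).
  { intros m. destruct (shift_PI m) as (e & He & Hs). rewrite (proj1 (Hs _)), sin_neg.
    destruct He as [->| ->]; ring. }
  replace (IZR p * IZR q * s) with (- (IZR p * phi) + IZR (p * j + q * k) * PI).
  2:{ replace s with ((s + t) / 2 + (s - t) / 2) by field. rewrite HA, HB, plus_IZR, !mult_IZR. field; lra. }
  replace (IZR p * IZR q * t) with (- (IZR p * phi) + IZR (p * j - q * k) * PI).
  2:{ replace t with ((s + t) / 2 - (s - t) / 2) by field. rewrite HA, HB, minus_IZR, !mult_IZR. field; lra. }
  rewrite !Z0. apply cos_minus_half; rewrite !mult_IZR; unfold level2.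
  - replace s with ((s + t) / 2 + (s - t) / 2) at 1 by field. rewrite HA, HB. field; lra.
  - replace t with ((s + t) / 2 - (s - t) / 2) at 1 by field. rewrite HA, HB. field; lra.
Qed.

(** * Double points of the planar projection and their signs *)

(** The range of [phi] puts [p * phi] strictly between 0 and [PI]. Equality would allow
    [sin (p * A) = 0] and [sin (q * A + phi) = 0] together, a point of zero velocity about which the
    planar curve retraces itself. *)
Lemma planar_nondegenerate (p q m k : Z) (phi : R) :
  (0 < p)%Z -> 0 < phi < PI / IZR p -> IZR p * phi <> PI * IZR (m * p - q * k).
Proof.
  intros Hp Hphi E. apply IZR_lt in Hp. pose proof PI_RGT_0.
  assert (IZR p * phi < PI).
  { replace PI with (IZR p * (PI / IZR p)) by (field; lra). apply Rmult_lt_compat_l; lra. }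
  assert (0 < IZR p * phi) by (apply Rmult_lt_0_compat; lra).
  assert (H2 : 0 < IZR (m * p - q * k)) by nra. assert (H3 : IZR (m * p - q * k) < 1) by nra.
  apply lt_IZR in H2. apply lt_IZR in H3. lia.
Qed.

(** Each equality of cosines fixes either the half-difference or the half-sum. Two half-differences
    force [s] and [t] to be congruent since [p] and [q] are coprime, two half-sums contradict
    nondegeneracy, and the mixed cases are the two kinds. *)
Lemma planar_double_points (p q : Z) (phi s t : R) :
  (0 < p)%Z -> (0 < q)%Z -> rel_prime p q -> 0 < phi < PI / IZR p -> ~ congr s t ->
  cos (IZR p * s) = cos (IZR p * t) -> cos (IZR q * s + phi) = cos (IZR q * t + phi) ->
  (exists j k, (s + t) / 2 = PI * IZR j / IZR p /\ (s - t) / 2 = PI * IZR k / IZR q /\ ~ (q | k)%Z) \/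
  (exists j k, (s + t) / 2 = (PI * IZR j - phi) / IZR q /\ (s - t) / 2 = PI * IZR k / IZR p /\ ~ (p | k)%Z).
Proof.
  intros Hp Hq Hpq Hphi Hst Ex Ey.
  pose proof (IZR_lt _ _ Hp) as Hp'. pose proof (IZR_lt _ _ Hq) as Hq'. pose proof PI_RGT_0.
  assert (ND : forall (N : Z) k, (0 < N)%Z -> (s - t) / 2 = PI * IZR k / IZR N -> ~ (N | k)%Z).
  { intros N k HN E [l ->]. apply Hst. exists l. apply IZR_lt in HN. rewrite mult_IZR in E.
    replace (s - t) with (2 * ((s - t) / 2)) by field. rewrite E. field. lra. }
  assert (Ex' : (exists k, (s - t) / 2 = PI * IZR k / IZR p) \/ (exists j, (s + t) / 2 = PI * IZR j / IZR p)).
  { destruct (cos_eq_cases _ _ Ex) as [E|E]; apply sin_eq_0_0 in E; destruct E as [k E]; [left|right];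
      exists k; apply (Rmult_eq_reg_l (IZR p)); try lra;
      replace (IZR p * (PI * IZR k / IZR p)) with (IZR k * PI) by (field; lra); rewrite <- E; field. }
  assert (Ey' : (exists k, (s - t) / 2 = PI * IZR k / IZR q) \/ (exists j, (s + t) / 2 = (PI * IZR j - phi) / IZR q)).
  { destruct (cos_eq_cases _ _ Ey) as [E|E]; apply sin_eq_0_0 in E; destruct E as [k E]; [left|right];
      exists k; apply (Rmult_eq_reg_l (IZR q)); try lra.
    - replace (IZR q * (PI * IZR k / IZR q)) with (IZR k * PI) by (field; lra). rewrite <- E. field.
    - replace (IZR q * ((PI * IZR k - phi) / IZR q)) with (IZR k * PI - phi) by (field; lra). rewrite <- E. field. }
  destruct Ex' as [[k Ek]|[j Ej]], Ey' as [[l El]|[m Em]].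
  - exfalso. apply (ND p k Hp Ek). apply (Gauss p q k); auto. exists l.
    apply eq_IZR. rewrite !mult_IZR. apply (Rmult_eq_reg_l (PI / (IZR p * IZR q))).
    + transitivity (PI * IZR k / IZR p); [field; lra|]. rewrite <- Ek, El. field; lra.
    + apply Rgt_not_eq, Rdiv_lt_0_compat; nra.
  - right. exists m, k. auto.
  - left. exists j, l. auto.
  - exfalso. apply (planar_nondegenerate p q m j phi Hp Hphi).
    rewrite minus_IZR, !mult_IZR.
    assert (E : IZR p * IZR q * (PI * IZR j / IZR p) = IZR p * IZR q * ((PI * IZR m - phi) / IZR q)) by congruence.
    replace (IZR p * IZR q * (PI * IZR j / IZR p)) with (PI * IZR j * IZR q) in E by (field; lra).
    replace (IZR p * IZR q * ((PI * IZR m - phi) / IZR q)) with (IZR p * (PI * IZR m - phi)) in E by (field; lra).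
    lra.
Qed.

Lemma sin_frac_neq_0 (N n k : Z) :
  (0 < N)%Z -> rel_prime n N -> ~ (N | k)%Z -> sin (PI * IZR (n * k) / IZR N) <> 0.
Proof.
  intros HN Hn Hk E. apply sin_eq_0_0 in E. destruct E as [m E]. apply IZR_lt in HN. pose proof PI_RGT_0.
  apply Hk. apply (Gauss N n k); [|now apply rel_prime_sym]. exists m.
  apply eq_IZR. rewrite (mult_IZR m).
  apply (Rmult_eq_reg_l (PI / IZR N)); [|apply Rgt_not_eq, Rdiv_lt_0_compat; lra].
  transitivity (PI * IZR (n * k) / IZR N); [field; lra|]. rewrite E. field. lra.
Qed.

(** Changing [n] by a multiple of [2 * N * M] moves both sine arguments by multiples of [2 * PI].
    The first sine thus occurs squared and is nonzero, and the sign is that of the product in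
    [same_cell]. *)
Lemma crossing_sign (N M n k j l : Z) (a a' : R) :
  (0 < N)%Z -> (0 < M)%Z -> rel_prime n M -> ~ (M | k)%Z -> same_cell N a a' ->
  0 < (-2 * sin (PI * IZR (n * k) / IZR M) * sin (PI * (IZR (n * j) + a) / IZR N)) *
      (-2 * sin (PI * IZR ((n + 2 * (N * M) * l) * k) / IZR M)
          * sin (PI * (IZR ((n + 2 * (N * M) * l) * j) + a') / IZR N)).
Proof.
  intros HN HM Hn Hk Hc.
  pose proof (sin_frac_neq_0 M n k HM Hn Hk) as H0.
  apply IZR_lt in HN. apply IZR_lt in HM.
  replace (PI * IZR ((n + 2 * (N * M) * l) * k) / IZR M)
    with (PI * IZR (n * k) / IZR M + 2 * PI * IZR (N * l * k))
    by (rewrite ?mult_IZR, ?plus_IZR, ?mult_IZR; field; lra).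
  replace (PI * (IZR ((n + 2 * (N * M) * l) * j) + a') / IZR N)
    with (PI * (IZR (n * j) + a') / IZR N + 2 * PI * IZR (M * l * j))
    by (rewrite ?mult_IZR, ?plus_IZR, ?mult_IZR; field; lra).
  rewrite !sin_shift_2PI. specialize (Hc (n * j)%Z).
  set (S := sin (PI * IZR (n * k) / IZR M)) in *.
  assert (0 < S * S) by nra.
  set (u := sin (PI * (IZR (n * j) + a) / IZR N)) in *. set (v := sin (PI * (IZR (n * j) + a') / IZR N)) in *.
  assert (0 < (S * S) * (u * v)) by (apply Rmult_lt_0_compat; lra). lra.
Qed.

Lemma wave_crossings (p q n l : Z) (phi psi c psi' c' s t : R) :
  (0 < p)%Z -> (0 < q)%Z -> rel_prime p q -> rel_prime n p -> rel_prime n q ->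
  0 < phi < PI / IZR p ->
  same_cell p (level1 p psi) (level1 p psi') ->
  same_cell q (level2 p q n phi psi c) (level2 p q (n + 2 * (p * q) * l) phi psi' c') ->
  ~ congr s t ->
  cos (IZR p * s) = cos (IZR p * t) -> cos (IZR q * s + phi) = cos (IZR q * t + phi) ->
  0 < (wave p q n psi c s - wave p q n psi c t) *
      (wave p q (n + 2 * (p * q) * l) psi' c' s - wave p q (n + 2 * (p * q) * l) psi' c' t).
Proof.
  intros Hp Hq Hpq Hnp Hnq Hphi H1 H2 Hst Ex Ey.
  destruct (planar_double_points p q phi s t) as [(j & k & HA & HB & Hk)|(j & k & HA & HB & Hk)]; auto.
  - rewrite !(wave_minus_kind1 p q _ j k _ _ s t) by auto. now apply crossing_sign.
  - rewrite !(wave_minus_kind2 p q _ j k phi _ _ s t) by auto.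
    rewrite (Z.mul_comm p q). apply crossing_sign; auto. now rewrite (Z.mul_comm q p).
Qed.

Lemma is_derive_cos_affine (a b t : R) : is_derive (fun u => cos (a * u + b)) t (- (a * sin (a * t + b))).
Proof. auto_derive; auto. ring. Qed.

Lemma is_derive_cos_linear (a t : R) : is_derive (fun u => cos (a * u)) t (- a * sin (a * t)).
Proof. auto_derive; auto. ring. Qed.

Lemma lipschitz_scal_sin (a b c : R) : lipschitz (fun t => a * sin (b * t + c)).
Proof.
  apply lipschitz_tame, tame_mult; [apply tame_const|]. apply tame_sin, lipschitz_affine.
Qed.

Lemma lipschitz_ext (f g : R -> R) : (forall t, f t = g t) -> lipschitz f -> lipschitz g.
Proof. intros E (C & HC & H1). exists C. split; [lra|]. intros. rewrite <- !E. auto. Qed.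

Lemma regular_planar (p q : Z) (phi : R) :
  (0 < p)%Z -> (0 < q)%Z -> 0 < phi < PI / IZR p ->
  regular (fun t => cos (IZR p * t)) (fun t => cos (IZR q * t + phi)).
Proof.
  intros Hp Hq Hphi.
  pose proof (IZR_lt _ _ Hp) as Hp'. pose proof (IZR_lt _ _ Hq) as Hq'. pose proof PI_RGT_0.
  apply (regular_of_derive _ _ (fun t => - IZR p * sin (IZR p * t)) (fun t => - (IZR q * sin (IZR q * t + phi)))).
  - intros t. apply is_derive_cos_linear.
  - intros t. apply is_derive_cos_affine.
  - apply (lipschitz_ext (fun t => - IZR p * sin (IZR p * t + 0))); [intros; do 2 f_equal; ring|].
    apply lipschitz_scal_sin.
  - apply (lipschitz_ext (fun t => - IZR q * sin (IZR q * t + phi))); [intros; ring|].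
    apply lipschitz_scal_sin.
  - intros t. f_equal. apply periodic_sin_linear.
  - intros t. do 2 f_equal. rewrite <- (sin_shift_2PI q (IZR q * t + phi)). f_equal. ring.
  - intros t E1 E2.
    assert (S1 : sin (IZR p * t) = 0) by nra. assert (S2 : sin (IZR q * t + phi) = 0) by nra.
    apply sin_eq_0_0 in S1. apply sin_eq_0_0 in S2. destruct S1 as [k S1], S2 as [m S2].
    apply (planar_nondegenerate p q m k phi Hp Hphi). rewrite minus_IZR, !mult_IZR.
    replace phi with (IZR m * PI - IZR q * t) by lra.
    replace t with (IZR k * PI / IZR p); [field; lra|]. rewrite <- S1. field. lra.
Qed.

(** This concerns the projection to the [x], [z] plane, over which [y] is later treated as the
    height. Where [x] is stationary, [p * t] is a multiple of [PI], so the twist and its derivative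
    vanish, and the sine left in the derivative of [z] is nonzero by the condition on [level1]. *)
Lemma regular_wave (p q n : Z) (psi c : R) :
  (0 < p)%Z -> n <> 0%Z -> (forall m : Z, sin (PI * (IZR m + level1 p psi) / IZR p) <> 0) ->
  regular (fun t => cos (IZR p * t)) (wave p q n psi c).
Proof.
  intros Hp Hn Ha. apply IZR_lt in Hp. pose proof PI_RGT_0.
  set (N := IZR p * IZR q). set (A := fun t => IZR n * t + psi + c * (sin (N * t) * sin (N * t))).
  apply (regular_of_derive _ _ (fun t => - IZR p * sin (IZR p * t))
           (fun t => - sin (A t) * (IZR n + 2 * c * N * (sin (N * t) * cos (N * t))))).
  - intros t. apply is_derive_cos_linear.
  - intros t. unfold wave. fold N. auto_derive; auto. unfold A. ring.
  - apply (lipschitz_ext (fun t => - IZR p * sin (IZR p * t + 0))); [intros; do 2 f_equal; ring|].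
    apply lipschitz_scal_sin.
  - apply lipschitz_tame.
    apply (tame_ext (fun t => (-1 * sin (A t)) * (IZR n + 2 * c * N * (sin (N * t) * cos (N * t))))); [intros; ring|].
    apply tame_mult.
    + apply tame_mult; [apply tame_const|]. apply tame_sin, lipschitz_wave_phase.
    + apply tame_plus; [apply tame_const|]. apply tame_mult; [apply tame_const|].
      apply tame_mult; [apply tame_sin_linear|apply tame_cos_linear].
  - intros t. f_equal. apply periodic_sin_linear.
  - intros t. unfold A, N. rewrite <- mult_IZR.
    rewrite (periodic_sin_linear (p * q) t), (periodic_cos_linear (p * q) t).
    do 2 f_equal. rewrite <- (sin_shift_2PI n (IZR n * t + _ + _)). f_equal. ring.
  - intros t E1. assert (S1 : sin (IZR p * t) = 0) by nra. apply sin_eq_0_0 in S1. destruct S1 as [k S1].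
    assert (SN : sin (N * t) = 0).
    { apply sin_eq_0_1. exists (q * k)%Z. rewrite mult_IZR. unfold N.
      replace (IZR q * IZR k * PI) with (IZR q * (IZR k * PI)) by ring. rewrite <- S1. ring. }
    rewrite SN. unfold A. rewrite SN.
    replace (IZR n * t + psi + c * (0 * 0)) with (PI * (IZR (n * k) + level1 p psi) / IZR p).
    2:{ rewrite mult_IZR. unfold level1. replace t with (IZR k * PI / IZR p); [field; lra|].
        rewrite <- S1. field. lra. }
    specialize (Ha (n * k)%Z). apply not_0_IZR in Hn.
    rewrite Rmult_0_l, Rmult_0_r, Rplus_0_r. apply Rmult_integral_contrapositive. split; auto. lra.
Qed.

Lemma same_cell_sin (N : Z) (a a' : R) (m : Z) :
  same_cell N a a' -> sin (PI * (IZR m + a) / IZR N) <> 0.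
Proof. intros H E. specialize (H m). rewrite E in H. lra. Qed.

(** Embeddedness modulo the period on the whole line, a form stable under time shifts and under
    [carries]. *)
Definition simple (K : curve) : Prop := forall s t, K s = K t -> congr s t.

Lemma carries_twisted_same_crossings (p q n l : Z) (phi psi c psi' c' : R) :
  (0 < p)%Z -> (0 < q)%Z -> rel_prime p q -> rel_prime n p -> rel_prime n q ->
  0 < phi < PI / IZR p ->
  same_cell p (level1 p psi) (level1 p psi') ->
  same_cell q (level2 p q n phi psi c) (level2 p q (n + 2 * (p * q) * l) phi psi' c') ->
  carries (twisted p q n phi psi c) (twisted p q (n + 2 * (p * q) * l) phi psi' c').
Proof.
  intros. apply carries_same_crossings.
  - apply tame_cos_linear.
  - apply tame_cos_affine.
  - apply tame_wave.
  - apply tame_wave.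
  - apply periodic_cos_linear.
  - apply periodic_cos_affine.
  - apply periodic_wave.
  - apply periodic_wave.
  - now apply regular_planar.
  - intros s t Hst Ex Ey. now apply (wave_crossings p q n l phi).
Qed.

(** Comparing the curve with itself makes the crossing product a square, and its positivity says
    that the heights differ at every planar double point. *)
Lemma simple_twisted (p q n : Z) (phi psi c : R) :
  (0 < p)%Z -> (0 < q)%Z -> rel_prime p q -> rel_prime n p -> rel_prime n q ->
  0 < phi < PI / IZR p ->
  same_cell p (level1 p psi) (level1 p psi) ->
  same_cell q (level2 p q n phi psi c) (level2 p q n phi psi c) ->
  simple (twisted p q n phi psi c).
Proof.
  intros Hp Hq Hpq Hnp Hnq Hphi H1 H2 s t E. apply NNPP. intros N.
  injection E as Ex Ey Ez.
  pose proof (wave_crossings p q n 0 phi psi c psi c s t Hp Hq Hpq Hnp Hnq Hphi H1) as W.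
  rewrite Z.mul_0_r, Z.add_0_r in W. specialize (W H2 N Ex Ey). rewrite Ez, Rminus_diag in W. lra.
Qed.

(** Over the [x], [z] projection the phase enters only the remaining coordinate [y], which moves by
    at most [|phi' - phi|]. Exchanging [y] and [z] reduces the claim to [carries_perturb]. *)
Lemma carries_twisted_phase (p q n : Z) (phi psi c : R) :
  (0 < p)%Z -> n <> 0%Z -> (forall m : Z, sin (PI * (IZR m + level1 p psi) / IZR p) <> 0) ->
  simple (twisted p q n phi psi c) ->
  exists eps, 0 < eps /\ forall phi', Rabs (phi' - phi) < eps ->
    carries (twisted p q n phi psi c) (twisted p q n phi' psi c).
Proof.
  intros Hp Hn Ha Hs.
  destruct (carries_perturb (fun t => cos (IZR p * t)) (wave p q n psi c) (fun t => cos (IZR q * t + phi)))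
    as (eps & He & H).
  - apply tame_cos_linear.
  - apply tame_wave.
  - apply tame_cos_affine.
  - apply periodic_cos_linear.
  - apply periodic_wave.
  - apply periodic_cos_affine.
  - now apply regular_wave.
  - intros s t Hst Ex Ez Ey. apply Hst, Hs. unfold twisted, curve3. now rewrite Ex, Ey, Ez.
  - exists eps. split; auto. intros phi' Hphi'.
    eapply carries_trans; [apply carries_swap_yz|].
    eapply carries_trans; [|apply carries_swap_yz]. apply H.
    + apply tame_cos_affine.
    + apply periodic_cos_affine.
    + intros t. eapply Rle_lt_trans; [apply Rabs_cos_minus_le|].
      replace (IZR q * t + phi' - (IZR q * t + phi)) with (phi' - phi) by ring. auto.
Qed.

(** * Deformation of the planar phase *)

(** An equivalence relation with open classes on an interval has a single class: the supremum of the
    points up to [y] equivalent to [x] is itself equivalent to [x], and it cannot lie below [y]. *)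
Lemma interval_connected (l u : R) (E : R -> R -> Prop) :
  (forall x, E x x) -> (forall x y, E x y -> E y x) -> (forall x y z, E x y -> E y z -> E x z) ->
  (forall x, l < x < u -> exists eps, 0 < eps /\ forall y, Rabs (y - x) < eps -> E x y) ->
  forall x y, l < x < u -> l < y < u -> E x y.
Proof.
  intros Er Es Et Hloc.
  assert (W : forall x y, l < x < u -> l < y < u -> x <= y -> E x y).
  { intros x y Hx Hy Hxy.
    destruct (completeness (fun s => x <= s <= y /\ E x s)) as [m [Hm1 Hm2]].
    - exists y. intros s [Hs _]. lra.
    - exists x. split; [lra|auto].
    - assert (Hxm : x <= m) by (apply Hm1; split; [lra|auto]).
      assert (Hmy : m <= y) by (apply Hm2; intros s [Hs _]; lra).
      destruct (Hloc m ltac:(lra)) as (eps & He & HE).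
      assert (Exm : E x m).
      { apply NNPP. intros N. apply (Rlt_irrefl m).
        apply (Rle_lt_trans _ (m - eps)); [|lra]. apply Hm2. intros s [Hs Hxs].
        apply Rnot_lt_le. intros Hlt. apply N. apply (Et x s m Hxs), Es, HE.
        assert (s <= m) by (apply Hm1; auto). apply Rabs_lt_between. lra. }
      destruct (Req_dec m y) as [<-|Nm]; auto. exfalso.
      set (s := Rmin y (m + eps / 2)).
      assert (s <= y) by apply Rmin_l. assert (s <= m + eps / 2) by apply Rmin_r.
      assert (m < s) by (apply Rmin_glb_lt; lra).
      assert (s <= m); [|lra]. apply Hm1. split; [lra|].
      apply (Et x m s Exm), HE. apply Rabs_lt_between. lra. }
  intros x y Hx Hy. destruct (Rle_dec x y); [auto|]. apply Es, W; auto. lra.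
Qed.

(* The coefficient [c] for which [level2 p q n phi psi c = b]. *)
Definition twist (p q n : Z) (phi psi b : R) : R :=
  (PI * b + IZR n * phi - IZR q * psi) / (IZR q * (sin (IZR p * phi) * sin (IZR p * phi))).

(** Parametrized by the two levels instead of [psi] and [c], so that [phi] can move while both
    levels stay fixed. *)
Definition cell_curve (p q n : Z) (a b phi : R) : curve :=
  twisted p q n phi (PI * a / IZR p) (twist p q n phi (PI * a / IZR p) b).

Lemma level1_cell (p : Z) (a : R) : (0 < p)%Z -> level1 p (PI * a / IZR p) = a.
Proof. intros Hp. apply IZR_lt in Hp. pose proof PI_RGT_0. unfold level1. field. lra. Qed.

Lemma sin_phase_pos (p : Z) (phi : R) : (0 < p)%Z -> 0 < phi < PI / IZR p -> 0 < sin (IZR p * phi).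
Proof.
  intros Hp Hphi. apply IZR_lt in Hp. apply sin_gt_0; [nra|].
  replace PI with (IZR p * (PI / IZR p)) by (field; lra). apply Rmult_lt_compat_l; lra.
Qed.

Lemma level2_cell (p q n : Z) (phi psi b : R) :
  (0 < p)%Z -> (0 < q)%Z -> 0 < phi < PI / IZR p ->
  level2 p q n phi psi (twist p q n phi psi b) = b.
Proof.
  intros Hp Hq Hphi. pose proof (sin_phase_pos p phi Hp Hphi).
  apply IZR_lt in Hq. pose proof PI_RGT_0. unfold level2, twist. field. lra.
Qed.

(** Locally the move has two stages: [phi] changes to [phi'] with [psi] and [c] frozen, then [c] is
    corrected at [phi'] to restore the level [b]. The correction preserves crossings because
    [level2] has not left its unit interval. *)
Lemma carries_cell_curve_phase (p q n i j : Z) (a b phi phi' : R) :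
  (1 < p)%Z -> (0 < q)%Z -> rel_prime p q -> rel_prime n p -> rel_prime n q ->
  IZR i < a < IZR i + 1 -> IZR j < b < IZR j + 1 ->
  0 < phi < PI / IZR p -> 0 < phi' < PI / IZR p ->
  carries (cell_curve p q n a b phi) (cell_curve p q n a b phi').
Proof.
  intros Hp1 Hq Hpq Hnp Hnq Ha Hb. assert (Hp : (0 < p)%Z) by lia.
  assert (Hn : n <> 0%Z).
  { intros ->. apply Zis_gcd_gcd in Hnp; [|lia]. rewrite Z.gcd_0_l in Hnp. lia. }
  revert phi phi'.
  apply (interval_connected 0 (PI / IZR p) (fun u v => carries (cell_curve p q n a b u) (cell_curve p q n a b v))).
  - intros. apply carries_refl.
  - intros. now apply carries_sym.
  - intros. eapply carries_trans; eauto.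
  - intros phi Hphi. unfold cell_curve at 1. set (psi := PI * a / IZR p). set (c := twist p q n phi psi b).
    assert (Sa : same_cell p (level1 p psi) (level1 p psi)).
    { unfold psi. rewrite level1_cell by auto. apply (same_cell_of_floor p i 0); auto; rewrite ?Rmult_0_r; lra. }
    assert (Lb : level2 p q n phi psi c = b) by (now apply level2_cell).
    destruct (carries_twisted_phase p q n phi psi c) as (e1 & He1 & H1); auto.
    { intros m. now apply (same_cell_sin p _ (level1 p psi)). }
    { apply simple_twisted; auto. rewrite Lb. apply (same_cell_of_floor q j 0); auto; rewrite ?Rmult_0_r; lra. }
    assert (LL : lipschitz (fun u => level2 p q n u psi c)).
    { apply (lipschitz_ext (fun u => (- IZR n / PI * u + IZR q * psi / PI)
        + (IZR q * c / PI) * (sin (IZR p * u) * sin (IZR p * u)))).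
      - intros u. unfold level2. pose proof PI_RGT_0. field. lra.
      - apply lipschitz_plus; [apply lipschitz_affine|]. apply lipschitz_tame.
        apply tame_mult; [apply tame_const|]. apply tame_mult; apply tame_sin_linear. }
    destruct LL as (C & HC & LL).
    (* [e2] keeps the drift of [level2], which is [C]-Lipschitz in the phase, below the distance
       from [b] to the ends of its interval; [e3] keeps [phi'] in the admissible range. *)
    set (e2 := Rmin (b - IZR j) (IZR j + 1 - b) / C).
    assert (He2 : 0 < e2) by (apply Rdiv_lt_0_compat; [apply Rmin_glb_lt|]; lra).
    set (e3 := Rmin phi (PI / IZR p - phi)).
    assert (He3 : 0 < e3) by (apply Rmin_glb_lt; lra).
    exists (Rmin e1 (Rmin e2 e3)). split; [apply Rmin_glb_lt; [|apply Rmin_glb_lt]; assumption|].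
    intros phi' Hd.
    pose proof (Rmin_l e1 (Rmin e2 e3)). pose proof (Rmin_r e1 (Rmin e2 e3)).
    pose proof (Rmin_l e2 e3). pose proof (Rmin_r e2 e3).
    assert (Hphi' : 0 < phi' < PI / IZR p).
    { assert (D3 : Rabs (phi' - phi) < e3) by lra. apply Rabs_lt_between in D3. unfold e3 in D3.
      pose proof (Rmin_l phi (PI / IZR p - phi)). pose proof (Rmin_r phi (PI / IZR p - phi)). lra. }
    eapply carries_trans; [apply (H1 phi'); lra|].
    unfold cell_curve. fold psi.
    pose proof (carries_twisted_same_crossings p q n 0 phi' psi c psi (twist p q n phi' psi b)) as S0.
    rewrite Z.mul_0_r, Z.add_0_r in S0. apply S0; auto.
    rewrite level2_cell by auto.
    assert (D : Rabs (level2 p q n phi' psi c - b) < Rmin (b - IZR j) (IZR j + 1 - b)).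
    { rewrite <- Lb at 1. eapply Rle_lt_trans; [apply LL|].
      replace (Rmin (b - IZR j) (IZR j + 1 - b)) with (C * e2) by (unfold e2; field; lra).
      apply Rmult_lt_compat_l; lra. }
    apply Rabs_lt_between in D.
    pose proof (Rmin_l (b - IZR j) (IZR j + 1 - b)). pose proof (Rmin_r (b - IZR j) (IZR j + 1 - b)).
    apply (same_cell_of_floor q j 0); auto; rewrite ?Rmult_0_r; lra.
Qed.

(** * Normal forms and counting *)

(** The midpoint of the admissible phases serves as common base point. *)
Definition model (p q n : Z) (a b : R) : curve := cell_curve p q n a b (PI / (2 * IZR p)).

Lemma half_phase (p : Z) : (0 < p)%Z -> 0 < PI / (2 * IZR p) < PI / IZR p.
Proof.
  intros Hp. apply IZR_lt in Hp. pose proof PI_RGT_0.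
  assert (0 < PI / (2 * IZR p)) by (apply Rdiv_lt_0_compat; lra).
  replace (PI / IZR p) with (PI / (2 * IZR p) + PI / (2 * IZR p)) by (field; lra). lra.
Qed.

Lemma carries_model_cell (p q n l i j ki kj : Z) (a a' b b' : R) :
  (0 < p)%Z -> (0 < q)%Z -> rel_prime p q -> rel_prime n p -> rel_prime n q ->
  IZR i < a < IZR i + 1 -> IZR i + 2 * IZR p * IZR ki < a' < IZR i + 1 + 2 * IZR p * IZR ki ->
  IZR j < b < IZR j + 1 -> IZR j + 2 * IZR q * IZR kj < b' < IZR j + 1 + 2 * IZR q * IZR kj ->
  carries (model p q n a b) (model p q (n + 2 * (p * q) * l) a' b').
Proof.
  intros Hp Hq Hpq Hnp Hnq Ha Ha' Hb Hb'. pose proof (half_phase p Hp).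
  apply carries_twisted_same_crossings; auto.
  - rewrite !level1_cell by auto. now apply (same_cell_of_floor p i ki).
  - rewrite !level2_cell by auto. now apply (same_cell_of_floor q j kj).
Qed.

(** Negating [n], [a] and [b] negates [psi] and [c], hence the whole phase of the wave, and cosine
    is even: the two curves coincide pointwise. *)
Lemma carries_model_opp (p q n : Z) (a b : R) :
  (0 < p)%Z -> (0 < q)%Z -> carries (model p q n a b) (model p q (- n) (- a) (- b)).
Proof.
  intros Hp Hq. apply carries_ext. intros t. unfold model, cell_curve, twisted, curve3, wave, twist.
  f_equal. pose proof (sin_phase_pos p _ Hp (half_phase p Hp)). apply IZR_lt in Hp. apply IZR_lt in Hq.
  rewrite <- cos_neg, opp_IZR. f_equal. field. lra.
Qed.

(** The shift adds [k * PI] to [psi] and leaves [c] unchanged, so it multiplies [z] by a sign. *)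
Lemma carries_model_shift (p q n k : Z) (a b : R) :
  (0 < p)%Z -> (0 < q)%Z ->
  carries (model p q n a b) (model p q n (a + IZR k * IZR p) (b + IZR k * IZR q)).
Proof.
  intros Hp Hq. destruct (shift_PI k) as (e & He & Hs).
  eapply carries_trans; [apply (carries_reflect 1 1 e); auto|].
  apply carries_ext. intros t. unfold curve3, model, cell_curve, twisted, curve3.
  pose proof (sin_phase_pos p _ Hp (half_phase p Hp)). apply IZR_lt in Hp. apply IZR_lt in Hq.
  f_equal; [f_equal; ring|]. unfold wave, twist. rewrite <- (proj2 (Hs _)). f_equal. field. lra.
Qed.

Lemma floor_Z (a : R) : exists i : Z, IZR i <= a < IZR i + 1.
Proof. destruct (archimed a) as [H1 H2]. exists (up a - 1)%Z. rewrite minus_IZR. lra. Qed.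

Lemma floor_nonint (a : R) : (forall i : Z, a <> IZR i) -> exists i : Z, IZR i < a < IZR i + 1.
Proof.
  intros H. destruct (floor_Z a) as [i Hi]. exists i. specialize (H i). lra.
Qed.

Lemma carries_model_box (p q n : Z) (a b : R) :
  (0 < p)%Z -> (0 < q)%Z -> rel_prime p q -> rel_prime n p -> rel_prime n q ->
  (forall i : Z, a <> IZR i) -> (forall i : Z, b <> IZR i) ->
  exists i j, (0 <= i < p)%Z /\ (0 <= j < 2 * q)%Z /\
    carries (model p q n a b) (model p q (n mod (2 * (p * q))) (IZR i + / 2) (IZR j + / 2)).
Proof.
  intros Hp Hq Hpq Hnp Hnq Ha Hb.
  destruct (floor_nonint a Ha) as [i Hi].
  (* The reflection shift brings the integer part of [a] into [[0, p)] at the price of moving [b].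
     Then [j] is reduced modulo [2 * q] and [n] modulo [2 * p * q] by invariance of the
     crossings. *)
  set (k := (- (i / p))%Z).
  destruct (floor_nonint (b + IZR k * IZR q)) as [j Hj].
  { intros l E. apply (Hb (l - k * q)%Z). rewrite minus_IZR, mult_IZR. lra. }
  exists (i mod p)%Z, (j mod (2 * q))%Z.
  split; [apply Z.mod_pos_bound; lia|]. split; [apply Z.mod_pos_bound; lia|].
  eapply carries_trans; [apply (carries_model_shift p q n k); auto|].
  assert (Ei : IZR i = IZR p * IZR (i / p) + IZR (i mod p)).
  { rewrite <- mult_IZR, <- plus_IZR. f_equal. apply Z.div_mod. lia. }
  assert (Ej : IZR j = 2 * IZR q * IZR (j / (2 * q)) + IZR (j mod (2 * q))).
  { rewrite <- !mult_IZR, <- plus_IZR. f_equal. apply Z.div_mod. lia. }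
  assert (En : (n mod (2 * (p * q)) = n + 2 * (p * q) * (- (n / (2 * (p * q)))))%Z).
  { pose proof (Z.div_mod n (2 * (p * q)) ltac:(nia)). lia. }
  rewrite En.
  apply (carries_model_cell p q n _ (i mod p) j 0 (- (j / (2 * q)))); auto.
  - unfold k. rewrite opp_IZR. lra.
  - rewrite Rmult_0_r. lra.
  - rewrite opp_IZR. lra.
Qed.

Lemma rel_prime_opp (n p : Z) : rel_prime n p -> rel_prime (- n) p.
Proof.
  intros H. apply rel_prime_bezout in H. destruct H as [u v E].
  apply bezout_rel_prime. exists (- u)%Z v. rewrite <- E. ring.
Qed.

Lemma rel_prime_mod_multiple (n p N : Z) :
  (0 < N)%Z -> (p | N)%Z -> rel_prime n p -> rel_prime (n mod N) p.
Proof.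
  intros HN [l ->] H. rewrite Z.mod_eq by lia.
  apply rel_prime_sym. apply rel_prime_sym in H.
  apply bezout_rel_prime. apply rel_prime_bezout in H. destruct H as [u v E].
  exists (u + v * (l * (n / (l * p))))%Z v. rewrite <- E. ring.
Qed.

(** A residue of [n] modulo [2 * p * q] above [p * q] is exchanged for one below by negating [n],
    [a] and [b]. *)
Lemma carries_model_canonical (p q n : Z) (a b : R) :
  (1 < p)%Z -> (1 < q)%Z -> rel_prime p q -> rel_prime n p -> rel_prime n q ->
  (forall i : Z, a <> IZR i) -> (forall i : Z, b <> IZR i) ->
  exists r i j, (0 <= r < p * q)%Z /\ rel_prime r p /\ rel_prime r q /\ (0 <= i < p)%Z /\ (0 <= j < 2 * q)%Z /\
    carries (model p q n a b) (model p q r (IZR i + / 2) (IZR j + / 2)).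
Proof.
  intros Hp Hq Hpq Hnp Hnq Ha Hb.
  assert (Dp : (p | 2 * (p * q))%Z) by (exists (2 * q)%Z; ring).
  assert (Dq : (q | 2 * (p * q))%Z) by (exists (2 * p)%Z; ring).
  assert (H0 : (0 < 2 * (p * q))%Z) by nia.
  pose proof (Z.mod_pos_bound n (2 * (p * q)) H0).
  destruct (Z_lt_le_dec (n mod (2 * (p * q))) (p * q)) as [Hr|Hr].
  - destruct (carries_model_box p q n a b) as (i & j & Hi & Hj & H'); auto; try lia.
    exists (n mod (2 * (p * q)))%Z, i, j.
    repeat (split; [solve [auto using rel_prime_mod_multiple | lia]|]). auto.
  - destruct (carries_model_box p q (- n) (- a) (- b)) as (i & j & Hi & Hj & H'); auto using rel_prime_opp; try lia.
    { intros l E. apply (Ha (- l)%Z). rewrite opp_IZR. lra. }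
    { intros l E. apply (Hb (- l)%Z). rewrite opp_IZR. lra. }
    exists ((- n) mod (2 * (p * q)))%Z, i, j.
    split.
    + rewrite Z.mod_opp_l_nz by lia.
      (* The residue [p * q] is excluded because it is divisible by [p > 1], while the residue is
         coprime to [p]. *)
      assert (n mod (2 * (p * q)) <> p * q)%Z; [|lia].
      intros E. pose proof (rel_prime_mod_multiple n p _ H0 Dp Hnp) as R. rewrite E in R.
      apply Zis_gcd_gcd in R; [|lia]. rewrite Z.gcd_comm, Z.gcd_mul_diag_l in R; lia.
    + repeat (split; [solve [auto using rel_prime_mod_multiple, rel_prime_opp | lia]|]).
      eapply carries_trans; [apply carries_model_opp; lia|auto].
Qed.

(** * Constraints imposed by embeddedness *)

(** In each coordinate the difference between the times [A + B] and [A - B] is a product of two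
    sines. If each product has a vanishing factor, the points coincide, and simplicity makes [2 * B]
    a multiple of [2 * PI]. *)
Lemma twisted_self_intersection (p q n : Z) (phi psi A B : R) :
  sin (IZR p * A) = 0 \/ sin (IZR p * B) = 0 ->
  sin (IZR q * A + phi) = 0 \/ sin (IZR q * B) = 0 ->
  sin (IZR n * A + psi) = 0 \/ sin (IZR n * B) = 0 ->
  simple (twisted p q n phi psi 0) -> exists k : Z, B = PI * IZR k.
Proof.
  intros H1 H2 H3 Hs. destruct (Hs (A + B) (A - B)) as [k Hk].
  - assert (E : forall u v a b, u = a + b -> v = a - b -> sin a = 0 \/ sin b = 0 -> cos u = cos v).
    { intros u v a b Eu Ev H.
      apply Rminus_diag_uniq. rewrite (cos_minus_half u v a b Eu Ev). destruct H as [-> | ->]; ring. }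
    unfold twisted, curve3, wave. f_equal; [f_equal|].
    + apply (E _ _ (IZR p * A) (IZR p * B)); auto; ring.
    + apply (E _ _ (IZR q * A + phi) (IZR q * B)); auto; ring.
    + apply (E _ _ (IZR n * A + psi) (IZR n * B)); auto; ring.
  - exists k. lra.
Qed.

Lemma sin_IZR_PI (m : Z) (u : R) : u = IZR m * PI -> sin u = 0.
Proof. intros ->. apply sin_eq_0_1. now exists m. Qed.

Lemma PI_fraction_not_int (d k : Z) : (1 < d)%Z -> PI / IZR d <> PI * IZR k.
Proof.
  intros Hd E. pose proof (IZR_lt _ _ Hd). pose proof PI_RGT_0.
  assert (E' : IZR d * IZR k = 1).
  { apply (Rmult_eq_reg_l PI); [|lra]. replace (PI * (IZR d * IZR k)) with (IZR d * (PI * IZR k)) by ring.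
    rewrite <- E. field. lra. }
  rewrite <- mult_IZR in E'. apply eq_IZR in E'. apply Z.eq_mul_1 in E'. lia.
Qed.

Lemma rel_prime_of_gcd (n p : Z) : (1 < p)%Z -> ~ (1 < Z.gcd n p)%Z -> rel_prime n p.
Proof.
  intros Hp H. apply Zgcd_1_rel_prime. pose proof (Z.gcd_nonneg n p).
  assert (Z.gcd n p <> 0)%Z by (rewrite Z.gcd_eq_0; lia). lia.
Qed.

Lemma sin_gcd (N d : Z) : (1 < d)%Z -> (d | N)%Z -> sin (IZR N * (PI / IZR d)) = 0.
Proof.
  intros Hd [m ->]. apply IZR_lt in Hd. apply (sin_IZR_PI m). rewrite mult_IZR. field. lra.
Qed.

Lemma simple_twisted_rel_prime (p q n : Z) (phi psi : R) :
  (1 < p)%Z -> (1 < q)%Z -> simple (twisted p q n phi psi 0) -> rel_prime n p /\ rel_prime n q.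
Proof.
  intros Hp Hq Hs. pose proof (IZR_lt _ _ Hq). split; apply rel_prime_of_gcd; auto; intros Hd.
  (* With [d = gcd n p], the choice [B = PI / d] kills the factors of [x] and [z], and
     [A = - phi / q] kills that of [y]. *)
  - destruct (twisted_self_intersection p q n phi psi (- phi / IZR q) (PI / IZR (Z.gcd n p))) as [k E]; auto.
    + right. apply sin_gcd; auto. apply Z.gcd_divide_r.
    + left. apply (sin_IZR_PI 0). field. lra.
    + right. apply sin_gcd; auto. apply Z.gcd_divide_l.
    + now apply PI_fraction_not_int in E.
  - destruct (twisted_self_intersection p q n phi psi 0 (PI / IZR (Z.gcd n q))) as [k E]; auto.
    + left. apply (sin_IZR_PI 0). ring.
    + right. apply sin_gcd; auto. apply Z.gcd_divide_r.
    + right. apply sin_gcd; auto. apply Z.gcd_divide_l.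
    + now apply PI_fraction_not_int in E.
Qed.

Lemma rel_prime_solve (n p i : Z) : rel_prime n p -> exists j m, (n * j + i = m * p)%Z.
Proof.
  intros H. apply rel_prime_bezout in H. destruct H as [u v E].
  exists (- (u * i))%Z, (v * i)%Z. replace i with (i * (u * n + v * p))%Z at 2 by (rewrite E; ring). ring.
Qed.

(** If the level were the integer [i], solving [n * j + i = m * p] would give a double point of the
    first kind, with half-sum [PI * j / p] and half-difference [PI / q], at which the heights agree
    too. *)
Lemma simple_twisted_level1 (p q n i : Z) (phi psi : R) :
  (1 < p)%Z -> (1 < q)%Z -> rel_prime n p -> simple (twisted p q n phi psi 0) -> level1 p psi <> IZR i.
Proof.
  intros Hp Hq Hn Hs E. pose proof (IZR_lt _ _ Hp). pose proof (IZR_lt _ _ Hq). pose proof PI_RGT_0.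
  destruct (rel_prime_solve n p i Hn) as (j & m & Ej).
  assert (Epsi : psi = PI * IZR i / IZR p) by (rewrite <- E; unfold level1; field; lra).
  destruct (twisted_self_intersection p q n phi psi (PI * IZR j / IZR p) (PI / IZR q)) as [k Ek]; auto.
  - left. apply (sin_IZR_PI j). field. lra.
  - right. apply sin_gcd; [lia|apply Z.divide_refl].
  - left. apply (sin_IZR_PI m). rewrite Epsi.
    replace (IZR m) with (IZR (m * p) / IZR p) by (rewrite mult_IZR; field; lra).
    rewrite <- Ej, plus_IZR, mult_IZR. field. lra.
  - now apply PI_fraction_not_int in Ek.
Qed.

Lemma simple_twisted_level2 (p q n i : Z) (phi psi : R) :
  (1 < p)%Z -> (1 < q)%Z -> rel_prime n q -> simple (twisted p q n phi psi 0) ->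
  level2 p q n phi psi 0 <> IZR i.
Proof.
  intros Hp Hq Hn Hs E. pose proof (IZR_lt _ _ Hp). pose proof (IZR_lt _ _ Hq). pose proof PI_RGT_0.
  destruct (rel_prime_solve n q i Hn) as (j & m & Ej).
  assert (Epsi : psi = (PI * IZR i + IZR n * phi) / IZR q) by (rewrite <- E; unfold level2; field; lra).
  destruct (twisted_self_intersection p q n phi psi ((PI * IZR j - phi) / IZR q) (PI / IZR p)) as [k Ek]; auto.
  - right. apply sin_gcd; [lia|apply Z.divide_refl].
  - left. apply (sin_IZR_PI j). field. lra.
  - left. apply (sin_IZR_PI m). rewrite Epsi.
    replace (IZR m) with (IZR (m * q) / IZR q) by (rewrite mult_IZR; field; lra).
    rewrite <- Ej, plus_IZR, mult_IZR. field. lra.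
  - now apply PI_fraction_not_int in Ek.
Qed.

Lemma simple_carries (K1 K2 : curve) : carries K1 K2 -> simple K1 -> simple K2.
Proof. intros H Hs s t E. apply Hs. now apply (carries_inj K1 K2). Qed.

Lemma nonint_sin (p m : Z) (a : R) :
  (0 < p)%Z -> (forall i : Z, a <> IZR i) -> sin (PI * (IZR m + a) / IZR p) <> 0.
Proof.
  intros Hp Ha. destruct (floor_nonint a Ha) as [i Hi].
  apply (same_cell_sin p a a). apply (same_cell_of_floor p i 0); auto; rewrite Rmult_0_r; lra.
Qed.

(** After a small move of [phi] into the open range, both levels are non-integral and the untwisted
    curve is the cell curve of its own levels, whose phase can slide to the base point. *)
Lemma carries_model_of_twisted (p q n : Z) (phi psi : R) :
  (1 < p)%Z -> (1 < q)%Z -> rel_prime p q -> 0 <= phi < PI / IZR p ->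
  simple (twisted p q n phi psi 0) ->
  exists a b, (forall i : Z, a <> IZR i) /\ (forall i : Z, b <> IZR i) /\
    carries (twisted p q n phi psi 0) (model p q n a b).
Proof.
  intros Hp Hq Hpq Hphi Hs.
  destruct (simple_twisted_rel_prime p q n phi psi) as [Hnp Hnq]; auto.
  assert (Ha : forall i : Z, level1 p psi <> IZR i) by (intros i; now apply (simple_twisted_level1 p q n i phi)).
  (* The value [phi = 0] is possible here. The perturbation lemma puts no range condition on [phi],
     so it can push the phase inside; [level1] does not depend on the phase. *)
  assert (Hphi' : exists phi', 0 < phi' < PI / IZR p /\ carries (twisted p q n phi psi 0) (twisted p q n phi' psi 0)).
  { destruct (carries_twisted_phase p q n phi psi 0) as (e & He & H); auto.
    - lia.
    - intros ->. apply Zis_gcd_gcd in Hnp; [|lia]. rewrite Z.gcd_0_l in Hnp. lia.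
    - intros m. apply nonint_sin; [lia|auto].
    - set (d := Rmin (e / 2) ((PI / IZR p - phi) / 2)).
      assert (0 < d) by (apply Rmin_glb_lt; lra).
      assert (d <= e / 2) by apply Rmin_l. assert (d <= (PI / IZR p - phi) / 2) by apply Rmin_r.
      exists (phi + d). split; [lra|]. apply H. replace (phi + d - phi) with d by ring.
      rewrite Rabs_pos_eq; lra. }
  destruct Hphi' as (phi' & Hphi' & Hc). pose proof (simple_carries _ _ Hc Hs) as Hs'.
  assert (Hb : forall i : Z, level2 p q n phi' psi 0 <> IZR i) by (intros i; now apply simple_twisted_level2).
  exists (level1 p psi), (level2 p q n phi' psi 0). do 2 (split; auto).
  eapply carries_trans; [apply Hc|].
  destruct (floor_nonint _ Ha) as [i Hi]. destruct (floor_nonint _ Hb) as [j Hj].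
  eapply carries_trans; [|apply (carries_cell_curve_phase p q n i j _ _ phi'); auto; try lia; apply half_phase; lia].
  pose proof (sin_phase_pos p phi' ltac:(lia) Hphi').
  pose proof (IZR_lt _ _ Hp). pose proof (IZR_lt _ _ Hq). pose proof PI_RGT_0.
  apply carries_ext. intros t. unfold cell_curve.
  replace (PI * level1 p psi / IZR p) with psi by (unfold level1; field; lra).
  replace (twist p q n phi' psi (level2 p q n phi' psi 0)) with 0; [reflexivity|].
  unfold twist, level2. field. lra.
Qed.

(** * From Lissajous knots to models *)

Lemma simple_liss (nx ny nz : nat) (px py pz : R) :
  embedded (liss nx ny nz px py pz) -> simple (liss nx ny nz px py pz).
Proof.
  intros He s t E.
  assert (P : forall k u, liss nx ny nz px py pz (u - 2 * PI * IZR k) = liss nx ny nz px py pz u).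
  { intros k u. unfold liss.
    assert (C : forall n ph, cos (INR n * (u - 2 * PI * IZR k) + ph) = cos (INR n * u + ph)).
    { intros n ph. rewrite INR_IZR_INZ.
      rewrite <- (periodic_Z _ (- k) u (periodic_cos_affine (Z.of_nat n) ph)).
      f_equal. rewrite opp_IZR. ring. }
    now rewrite !C. }
  destruct (euclid_2PI 0 s) as [k Hk], (euclid_2PI 0 t) as [l Hl].
  exists (k - l)%Z. rewrite minus_IZR.
  assert (s - 2 * PI * IZR k = t - 2 * PI * IZR l); [|lra].
  apply He; try lra. now rewrite !P.
Qed.

(** A time shift makes the [x] phase a multiple [k * PI], absorbed by a reflection, for any integer
    [k]. The choice of [k] changes the [y] phase by multiples of [PI * q / p]; since [q] is
    invertible modulo [p] and [y] may be reflected, that phase can be brought into [[0, PI / p)]. *)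
Lemma liss_normal_form (nx ny nz : nat) (px py pz : R) :
  (0 < nx)%nat -> rel_prime (Z.of_nat nx) (Z.of_nat ny) ->
  exists phi psi tau, 0 <= phi < PI / IZR (Z.of_nat nx) /\
    carries (fun t => liss nx ny nz px py pz (t + tau))
      (twisted (Z.of_nat nx) (Z.of_nat ny) (Z.of_nat nz) phi psi 0).
Proof.
  intros Hx Hxy. set (p := Z.of_nat nx) in *. set (q := Z.of_nat ny) in *. set (n := Z.of_nat nz) in *.
  assert (Hp : 0 < IZR p) by (apply (IZR_lt 0); unfold p; lia). pose proof PI_RGT_0.
  set (C0 := py - IZR q * px / IZR p).
  destruct (floor_Z (C0 * IZR p / PI)) as [m Hm].
  assert (EC : C0 = C0 * IZR p / PI * (PI / IZR p)) by (field; lra).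
  set (v := C0 * IZR p / PI) in *.
  apply rel_prime_sym, rel_prime_bezout in Hxy. destruct Hxy as [u w E].
  (* From [u * q + w * p = 1] one gets [q * k = p * l - m], so the shift lowers the [y] phase by
     [m * PI / p] up to [l * PI]. *)
  set (k := (- m * u)%Z). set (l := (m * w)%Z).
  assert (Ekl : IZR q * IZR k = IZR p * IZR l - IZR m).
  { rewrite <- !mult_IZR, <- minus_IZR. f_equal. unfold k, l.
    transitivity (p * (m * w) - m * (u * q + w * p))%Z; [ring|rewrite E; ring]. }
  set (tau := (- px + PI * IZR k) / IZR p).
  exists (C0 - PI * IZR m / IZR p), (pz + IZR n * tau), tau. split.
  { assert (0 < PI / IZR p) by (apply Rdiv_lt_0_compat; lra).
    replace (PI * IZR m / IZR p) with (IZR m * (PI / IZR p)) by (field; lra). rewrite EC. nra. }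
  destruct (shift_PI k) as (e1 & He1 & Hs1). destruct (shift_PI l) as (e2 & He2 & Hs2).
  apply carries_sym. eapply carries_trans; [apply (carries_reflect e1 e2 1); auto|].
  apply carries_ext. intros t. unfold liss, curve3, wave. rewrite !INR_IZR_INZ. fold p q n.
  rewrite <- (proj2 (Hs1 _)), <- (proj2 (Hs2 _)).
  f_equal; [f_equal|].
  - f_equal. unfold tau. field. lra.
  - f_equal.
    replace (IZR q * (t + tau)) with (IZR q * t + (- IZR q * px + PI * (IZR q * IZR k)) / IZR p)
      by (unfold tau; field; lra).
    rewrite Ekl. unfold C0. field. lra.
  - rewrite Rmult_1_l. f_equal. ring.
Qed.

Lemma simple_time_shift (K : curve) (tau : R) : simple K -> simple (fun t => K (t + tau)).
Proof. intros H s t E. destruct (H _ _ E) as [k Hk]. exists k. lra. Qed.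

Lemma lissajous_knot2_canonical (nx ny : nat) (K : curve) :
  (2 <= nx)%nat -> (2 <= ny)%nat -> rel_prime (Z.of_nat nx) (Z.of_nat ny) -> lissajous_knot2 nx ny K ->
  exists r i j, (0 <= r < Z.of_nat nx * Z.of_nat ny)%Z /\
    rel_prime r (Z.of_nat nx) /\ rel_prime r (Z.of_nat ny) /\
    (0 <= i < Z.of_nat nx)%Z /\ (0 <= j < 2 * Z.of_nat ny)%Z /\
    knot_equiv K (model (Z.of_nat nx) (Z.of_nat ny) r (IZR i + / 2) (IZR j + / 2)).
Proof.
  intros Hx Hy Hxy (nz & px & py & pz & -> & He).
  destruct (liss_normal_form nx ny nz px py pz) as (phi & psi & tau & Hphi & Hc); [lia|auto|].
  pose proof (simple_carries _ _ Hc (simple_time_shift _ tau (simple_liss _ _ _ _ _ _ He))) as Hs.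
  assert (Hp : (1 < Z.of_nat nx)%Z) by lia. assert (Hq : (1 < Z.of_nat ny)%Z) by lia.
  destruct (carries_model_of_twisted _ _ _ _ _ Hp Hq Hxy Hphi Hs) as (a & b & Ha & Hb & Hm).
  destruct (simple_twisted_rel_prime _ _ _ _ _ Hp Hq Hs) as [Hnp Hnq].
  destruct (carries_model_canonical _ _ _ a b Hp Hq Hxy Hnp Hnq Ha Hb)
    as (r & i & j & Hr & Hrp & Hrq & Hi & Hj & Hf).
  exists r, i, j. do 5 (split; [assumption|]).
  eapply knot_equiv_trans; [apply (knot_equiv_time_shift _ tau)|].
  apply knot_equiv_carries. eapply carries_trans; [exact Hc|]. eapply carries_trans; [exact Hm|exact Hf].
Qed.

(** * Counting the models *)

(** Pairwise inequivalent curves receive distinct representatives in [L]. The representatives are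
    collected along the list, remembering that each is equivalent to some curve already treated, so
    that a repetition would give two equivalent curves. *)
Lemma at_most_types_cover (P : curve -> Prop) (L : list curve) (N : nat) :
  (length L <= N)%nat -> (forall K, P K -> exists M, In M L /\ knot_equiv K M) -> at_most_types P N.
Proof.
  intros HL Hcov l Hl Hne.
  assert (C : exists l', length l' = length l /\ incl l' L /\ NoDup l' /\
                forall M, In M l' -> exists K, In K l /\ knot_equiv K M).
  { induction Hne as [|K l HK Hne IH].
    - exists nil. repeat split; [intros M []|constructor|intros M []].
    - inversion Hl as [|K0 l0 PK Pl]; subst. destruct (IH Pl) as (l' & E & Hi & Hn & Hk).
      destruct (Hcov K PK) as (M & HM & HKM). exists (M :: l'). repeat split.
      + simpl. now rewrite E.
      + intros M' [<-|H]; auto.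
      + constructor; auto. intros HMl. destruct (Hk M HMl) as (K' & HK' & HK'M).
        rewrite Forall_forall in HK. apply (HK K' HK').
        eapply knot_equiv_trans; [exact HKM|now apply knot_equiv_sym].
      + intros M' [<-|H].
        * exists K. split; [left|]; auto.
        * destruct (Hk M' H) as (K' & HK' & HE). exists K'. split; [right|]; auto. }
  destruct C as (l' & E & Hi & Hn & _). rewrite <- E.
  eapply Nat.le_trans; [apply (NoDup_incl_length Hn Hi)|exact HL].
Qed.

Definition coprime_residues (nx ny : nat) : list nat :=
  filter (fun r => (Nat.gcd r nx =? 1)%nat && (Nat.gcd r ny =? 1)%nat)%bool (seq 0 (nx * ny)).

(** By the Chinese remainder theorem a residue is determined by its remainders modulo [nx] and [ny],
    and coprimality makes both of them nonzero. *)
Lemma coprime_residues_length (nx ny : nat) :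
  (2 <= nx)%nat -> (2 <= ny)%nat -> rel_prime (Z.of_nat nx) (Z.of_nat ny) ->
  (length (coprime_residues nx ny) <= (nx - 1) * (ny - 1))%nat.
Proof.
  intros Hx Hy Hxy.
  set (f := fun r => ((r mod nx)%nat, (r mod ny)%nat)).
  rewrite <- (length_map f).
  replace ((nx - 1) * (ny - 1))%nat with (length (list_prod (seq 1 (nx - 1)) (seq 1 (ny - 1))))
    by (now rewrite length_prod, !length_seq).
  apply NoDup_incl_length.
  - apply NoDup_map_NoDup_ForallPairs; [|apply NoDup_filter, seq_NoDup].
    intros r s Hr Hs E. unfold coprime_residues in *. apply filter_In in Hr. apply filter_In in Hs.
    destruct Hr as [Hr _], Hs as [Hs _]. apply in_seq in Hr. apply in_seq in Hs.
    unfold f in E. injection E as E1 E2.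
    assert (D : forall N, (0 < N)%nat -> (r mod N = s mod N)%nat -> (Z.of_nat N | Z.of_nat r - Z.of_nat s)%Z).
    { intros N HN EN. exists (Z.of_nat (r / N) - Z.of_nat (s / N))%Z.
      pose proof (Nat.div_mod r N ltac:(lia)). pose proof (Nat.div_mod s N ltac:(lia)). nia. }
    destruct (D ny ltac:(lia) E2) as [u Eu].
    assert (Du : (Z.of_nat nx | Z.of_nat ny * u)%Z) by (rewrite Z.mul_comm, <- Eu; apply D; auto; lia).
    destruct (Gauss _ _ _ Du Hxy) as [w ->].
    (* [r - s] is [w] times [nx * ny], while [r] and [s] both lie in [[0, nx * ny)]. *)
    assert (w = 0)%Z by nia. subst w. lia.
  - intros [a b] H. apply in_map_iff in H. destruct H as (r & E & Hr). injection E as <- <-.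
    apply filter_In in Hr. destruct Hr as [_ Hr]. apply andb_prop in Hr. destruct Hr as [H1 H2].
    apply Nat.eqb_eq in H1. apply Nat.eqb_eq in H2.
    assert (D : forall N, (2 <= N)%nat -> Nat.gcd r N = 1%nat -> In (r mod N)%nat (seq 1 (N - 1))).
    { intros N HN HG. apply in_seq. pose proof (Nat.mod_upper_bound r N ltac:(lia)).
      assert (r mod N <> 0)%nat; [|lia]. intros E.
      apply Nat.Div0.mod_divides in E. destruct E as [k ->].
      rewrite Nat.gcd_comm, Nat.gcd_mul_diag_l in HG; lia. }
    apply in_prod; auto.
Qed.

Lemma rel_prime_of_nat (m n : nat) : rel_prime (Z.of_nat m) (Z.of_nat n) <-> Nat.gcd m n = 1%nat.
Proof.
  split.
  - intros [_ _ H].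
    assert (D : forall k, Nat.divide (Nat.gcd m n) k -> (Z.of_nat (Nat.gcd m n) | Z.of_nat k)%Z).
    { intros k [l ->]. exists (Z.of_nat l). apply Nat2Z.inj_mul. }
    specialize (H _ (D m (Nat.gcd_divide_l m n)) (D n (Nat.gcd_divide_r m n))).
    apply Z.divide_1_r in H. lia.
  - intros E. apply bezout_rel_prime.
    destruct (Nat.gcd_bezout m n) as [(u & v & H)|(u & v & H)]; rewrite E in H.
    + exists (Z.of_nat u) (- Z.of_nat v)%Z. nia.
    + exists (- Z.of_nat v)%Z (Z.of_nat u). nia.
Qed.

Lemma at_most_types_lissajous_knot2 (nx ny : nat) :
  (2 <= nx)%nat -> (2 <= ny)%nat -> rel_prime (Z.of_nat nx) (Z.of_nat ny) ->
  at_most_types (lissajous_knot2 nx ny) ((nx - 1) * (ny - 1) * (nx * (2 * ny))).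
Proof.
  intros Hx Hy Hxy.
  apply (at_most_types_cover _ (map (fun '(r, (i, j)) =>
      model (Z.of_nat nx) (Z.of_nat ny) (Z.of_nat r) (IZR (Z.of_nat i) + / 2) (IZR (Z.of_nat j) + / 2))
    (list_prod (coprime_residues nx ny) (list_prod (seq 0 nx) (seq 0 (2 * ny)))))).
  - rewrite length_map, !length_prod, !length_seq. apply Nat.mul_le_mono_r.
    now apply coprime_residues_length.
  - intros K HK.
    destruct (lissajous_knot2_canonical nx ny K Hx Hy Hxy HK) as (r & i & j & Hr & Hrp & Hrq & Hi & Hj & HE).
    assert (G : forall N, rel_prime r (Z.of_nat N) -> (Nat.gcd (Z.to_nat r) N =? 1)%nat = true).
    { intros N H. apply Nat.eqb_eq, rel_prime_of_nat. now rewrite Z2Nat.id by lia. }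
    eexists. split; [|exact HE].
    apply in_map_iff. exists (Z.to_nat r, (Z.to_nat i, Z.to_nat j)). split.
    + now rewrite !Z2Nat.id by lia.
    + apply in_prod; [|apply in_prod; apply in_seq; lia].
      apply filter_In. split; [apply in_seq; nia|]. now rewrite !G.
Qed.

Lemma at_most_types_weaken (P : curve -> Prop) (M N : nat) :
  (M <= N)%nat -> at_most_types P M -> at_most_types P N.
Proof. intros HMN H l Hl Hne. specialize (H l Hl Hne). lia. Qed.

Theorem theorem4 (nx ny : nat) :
  (2 <= nx)%nat -> (2 <= ny)%nat -> Nat.gcd nx ny = 1%nat ->
  at_most_types (lissajous_knot2 nx ny) (4 * nx * ny * (nx - 1) * (ny - 1))%nat /\
  (nx = 2%nat ->
   at_most_types (lissajous_knot2 2 ny) (2 * (ny - 1) * (2 * ny + 1))%nat).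
Proof.
  intros Hx Hy Hg.
  apply rel_prime_of_nat in Hg.
  pose proof (at_most_types_lissajous_knot2 nx ny Hx Hy Hg) as H. split.
  - eapply at_most_types_weaken; [|exact H].
    (* The count [2 * nx * ny * u] is half of the general bound. *)
    set (u := ((nx - 1) * (ny - 1))%nat). nia.
  (* For [nx = 2] the count is [4 * ny * (ny - 1)], and the bound exceeds it by [2 * (ny - 1)]. *)
  - intros ->. eapply at_most_types_weaken; [|exact H]. simpl (2 - 1)%nat. nia.
Qed.
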